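(* Let $\mathcal{A}$ be a central, essential hyperplane arrangement in $V=\mathbb{R}^d$ with faces $\mathcal{F}$, chambers $\mathcal{C}$ and intersection lattice $\mathcal{L}$, and let $W\subseteq GL(V)$ be a finite group preserving $\mathcal{A}$. Let $\{p_x\}_{x\in\mathcal{F}}$ be nonnegative real numbers with $p_{gx}=p_x$ for all $g\in W$, $x\in\mathcal{F}$, and let $T$ act on $\mathbb{R}\mathcal{C}$ by left multiplication by $a=\sum_{x\in\mathcal{F}}p_xx\in\mathbb{R}\mathcal{F}$. For $X\in\mathcal{L}$ put $\lambda_X=\sum_{x\in\mathcal{F}: x\subseteq X}p_x$. Then the $\mathbb{R}[T][W]$-module $\mathbb{R}\mathcal{C}$ is semisimple, its $T$-eigenvalues lie in $\{\lambda_X\}_{X\in\mathcal{L}}$, and for each $\lambda$, the $\lambda$-eigenspace $(\mathbb{R}\mathcal{C})_\lambda=\ker(T-\lambda)$ satisfies, in the Grothendieck group $\Gamma(\mathbb{R}W)$, $$(\mathbb{R}\mathcal{C})_\lambda=\sum_{X^W\in\mathcal{L}/W:\ \lambda_X=\lambda}\mathrm{Ind}_{\mathrm{Stab}_W(X)}^W\Bigl(\widetilde H^*((V,X);\mathbb{R})\otimes\det{}_{V/X}\Bigr),$$ the sum being over $W$-orbits $X^W$ of $\mathcal{L}$ (one representative $X$ each) with $\lambda_X=\lambda$.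
   Context: Faces: equivalence classes of points of $V$ under $v\equiv v'$ iff for each $H\in\mathcal{A}$ both lie on the same open side of $H$ or both lie on $H$; chambers are full-dimensional faces. Product: $x\circ y$ is the face lying, for each $H$, on the side of $x$ if $x\not\subseteq H$, on the side of $y$ if $x\subseteq H$ and $y\not\subseteq H$, and in $H$ if both lie in $H$; $\mathbb{R}\mathcal{C}$ is a left ideal of $\mathbb{R}\mathcal{F}$. $\mathcal{L}$ is the set of intersections of subsets of $\mathcal{A}$, ordered by reverse inclusion, with minimum $V$. $(V,X)$ is the open interval $\{Y\in\mathcal{L}: X\subsetneq Y\subsetneq V\}$; $\widetilde H^*((V,X);\mathbb{R})=\bigoplus_i\widetilde H^i$ is the reduced cohomology of its order complex (the simplicial complex of its chains), with the action of the setwise stabilizer $\mathrm{Stab}_W(X)$; the empty order complex has reduced cohomology $\mathbb{R}$ (trivial action) in degree $-1$, and for $X=V$ the term $\widetilde H^*((V,V);\mathbb{R})$ is the trivial one-dimensional representation. $\det_{V/X}$ is the determinant character of $\mathrm{Stab}_W(X)$ acting on $V/X$. $\Gamma(\mathbb{R}W)$ is the Grothendieck group of finite-dimensional $\mathbb{R}W$-modules. *)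

(* Defs.v *)
From HB Require Import structures.
From mathcomp Require Import all_boot all_order all_algebra all_fingroup.
From mathcomp Require Import mxrepresentation character.
From mathcomp Require Import boolp.
From mathcomp Require Import lra.
From mathcomp Require freeg.

Set Implicit Arguments.
Unset Strict Implicit.
Unset Printing Implicit Defensive.

Import Order.TTheory GRing.Theory Num.Theory.
Local Open Scope ring_scope.

(* Vectors are rows, linear maps act on the right ([v *m M]), and a group    *)
(* element g acts by [v *m rG g], as in mathcomp's [mx_representation].      *)
(* Every module below is a right RW-module; setting g v := v *m rG g^-1      *)
(* turns all of them simultaneously into left RW-modules.                    *)

Section Representations.

Variables (R : fieldType) (gT : finGroupType).

(* An exact sequence 0 -> M1 -> M2 -> M3 -> 0 of RG-modules. *)
Definition short_exact (G : {group gT}) (M1 M2 M3 : representation R G) :=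
  exists (i : 'M[R]_(rdegree M1, rdegree M2))
         (q : 'M[R]_(rdegree M2, rdegree M3)),
    [/\ {in G, forall g, M1 g *m i = i *m M2 g},
        {in G, forall g, M2 g *m q = q *m M3 g},
        row_free i, row_full q & (i :=: kermx q)%MS].

Section Permutation.

Variables (S : finType) (D : {group gT}) (to : action D S).
Variables (H : {group gT}) (B : {set S}).

(* The matrix of [e_x |-> e_(to x g)] on the free module with basis B. *)
Definition perm_repr_mx (g : gT) : 'M[R]_#|B| :=
  \matrix_(i, j) (to (enum_val i) g == enum_val j)%:R.

Hypothesis nB : [acts H, on B | to].

Lemma perm_repr_mulmx n (F : S -> 'I_n -> R) g (gH : g \in H) i k :
  (perm_repr_mx g *m \matrix_(i, j) F (enum_val i) j) i k
    = F (to (enum_val i) g) k.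
Proof.
have xB : to (enum_val i) g \in B by rewrite (acts_act nB) // enum_valP.
rewrite mxE (bigD1 (enum_rank_in xB (to (enum_val i) g))) //= !mxE.
rewrite enum_rankK_in // eqxx mul1r big1 ?addr0 // => j nej.
rewrite !mxE; case: eqP => [e|_]; last by rewrite mul0r.
by case/eqP: nej; apply: enum_val_inj; rewrite enum_rankK_in.
Qed.

Lemma perm_repr_proof : mx_repr H perm_repr_mx.
Proof.
have sHD : H \subset D := acts_dom nB.
split=> [|g h gH hH].
  have to1 x : to x 1%g = x.
    by apply: (act_inj to 1%g); rewrite -actMin ?group1 // mulg1.
  apply/matrixP=> i j; rewrite !mxE to1 -[RHS]/((i == j)%:R).
  by rewrite (inj_eq enum_val_inj).
apply/matrixP=> i k.
have := perm_repr_mulmx (fun x k => (to x h == enum_val k)%:R) gH i k.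
rewrite /perm_repr_mx => ->; rewrite mxE actMin //; exact: (subsetP sHD).
Qed.

Definition perm_repr : mx_representation R H #|B| :=
  MxRepresentation perm_repr_proof.

End Permutation.

Lemma perm_repr_comm (S S' : finType) (D D' : {group gT})
    (to : action D S) (to' : action D' S') (H : {group gT})
    (B : {set S}) (B' : {set S'})
    (nB : [acts H, on B | to]) (nB' : [acts H, on B' | to'])
    (F : S -> S' -> R) :
  {in H, forall g x y, F (to x g) (to' y g) = F x y} ->
  let M := \matrix_(i < #|B|, j < #|B'|) F (enum_val i) (enum_val j) in
  {in H, forall g, perm_repr nB g *m M = M *m perm_repr nB' g}.
Proof.
move=> FH M g gH; apply/matrixP=> i k.
rewrite (perm_repr_mulmx nB (fun x k => F x (enum_val k)) gH i k).
have gD : g \in D' by exact: (subsetP (acts_dom nB')).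
set y := to' (enum_val k) g^-1%g.
have gVH : g^-1%g \in H by rewrite groupV.
have yB : y \in B' by rewrite (acts_act nB') // enum_valP.
have yg : to' y g = enum_val k.
  have gVD : g^-1%g \in D' by exact: (subsetP (acts_dom nB')).
  by rewrite /y -actMin // mulVg act1.
rewrite mxE (bigD1 (enum_rank_in yB y)) //= !mxE enum_rankK_in //.
rewrite yg eqxx mulr1 big1 ?addr0 => [|j nej].
  by rewrite -{1}yg FH.
rewrite !mxE; case: eqP => [e|_]; last by rewrite mulr0.
have : enum_val j = y by apply: (act_inj to' g); rewrite e yg.
move=> e'; case/eqP: nej; apply: enum_val_inj; by rewrite enum_rankK_in.
Qed.

Section Induction.

Variables (G H : {group gT}) (sHG : H \subset G).
Variables (n : nat) (rH : mx_representation R H n).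

Definition coset_rep (i : 'I_#|rcosets H G|) : gT := repr (enum_val i).

(* M (x)_{RH} RG, decomposed as the direct sum of the M (x) x_i, where the   *)
(* x_i represent the right cosets of H in G; (m (x) x_i) g = m h (x) x_j     *)
(* if x_i g = h x_j with h in H.                                             *)
Definition ind_repr_mx (g : gT) : 'M[R]_(\sum_(i < #|rcosets H G|) n) :=
  \mxblock_(i < #|rcosets H G|, j < #|rcosets H G|)
    (if (coset_rep i * g * (coset_rep j)^-1)%g \in H
     then rH (coset_rep i * g * (coset_rep j)^-1)%g else 0).

Lemma coset_rep_inj i j (x := coset_rep i) :
  (x * (coset_rep j)^-1)%g \in H -> i = j.
Proof.
rewrite /x -mem_rcoset; set z := coset_rep j => xz.
have E k : enum_val k = (H :* coset_rep k)%g.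
  have /rcosetsP[u _ e] := enum_valP k.
  by rewrite /coset_rep e rcoset_repr.
by apply: enum_val_inj; rewrite !E; apply/rcoset_eqP.
Qed.

Lemma ind_repr_proof : mx_repr G ind_repr_mx.
Proof.
have repG i : coset_rep i \in G.
  have /rcosetsP[u uG e] := enum_valP i; rewrite /coset_rep e.
  have /rcosetP[h hH ->] := mem_repr_rcoset H u.
  by rewrite groupM // (subsetP sHG).
split=> [|g h gG hG].
  rewrite -(mxdiagZ (p_ := fun=> n)) /mxdiag; apply: eq_mxblock => i j.
  rewrite mulg1 conform_mx_id; case: eqVneq => [->|neij].
    by rewrite mulgV group1 repr_mx1.
  by case: ifP => // /coset_rep_inj e; rewrite e eqxx in neij.
rewrite /ind_repr_mx mul_mxblock; apply: eq_mxblock => i k.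
set x := coset_rep i; set z := coset_rep k.
pose P j := (x * g * (coset_rep j)^-1)%g \in H.
have [j0 Pj0] : exists j, P j.
  have C : (H :* (x * g))%g \in rcosets H G.
    by apply/rcosetsP; exists (x * g)%g; rewrite ?groupM ?repG.
  exists (enum_rank_in C (H :* (x * g))%g).
  rewrite /P -mem_rcoset /coset_rep enum_rankK_in // rcoset_repr.
  exact: rcoset_refl.
rewrite (bigD1 j0) //= -/(P j0) Pj0 big1 ?addr0 => [|j nej]; last first.
  case: ifP => [Pj|]; last by rewrite mul0mx.
  case/eqP: nej; apply: coset_rep_inj.
  have := groupM (groupVr Pj) Pj0; rewrite !invMg !invgK !mulgA.
  by rewrite mulgKV mulgKV.
have -> : (x * (g * h) * z^-1 = (x * g * (coset_rep j0)^-1)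
   * (coset_rep j0 * h * z^-1))%g by rewrite !mulgA mulgKV.
rewrite groupMl //; case: ifP => Q; last by rewrite mulmx0.
by rewrite repr_mxM.
Qed.

Definition ind_repr : mx_representation R G (\sum_(i < #|rcosets H G|) n) :=
  MxRepresentation ind_repr_proof.

End Induction.

Section Determinant.

Variables (G : {group gT}) (n : nat) (rG : mx_representation R G n).

Lemma det_repr_proof : mx_repr G (fun g => (\det (rG g))%:M : 'M[R]_1).
Proof.
split=> [|g h Gg Gh]; first by rewrite repr_mx1 det1.
by rewrite repr_mxM // det_mulmx scalar_mxM.
Qed.

Definition det_repr : mx_representation R G 1 := MxRepresentation det_repr_proof.

End Determinant.

Section Semisimple.

Variables (G : {group gT}) (n : nat) (rG : mx_representation R G n).
Variable T : 'M[R]_n.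

(* R[T][W]-submodules: the subspaces stable under both G and T. *)
Definition mxmoduleT (U : 'M[R]_n) := mxmodule rG U && stablemx U T.

Definition mxsimpleT (U : 'M[R]_n) :=
  [/\ mxmoduleT U, U != 0
    & forall V : 'M[R]_n, mxmoduleT V -> (V <= U)%MS -> V != 0 -> (U <= V)%MS].

Definition mxsemisimpleT :=
  exists (J : finType) (U : J -> 'M[R]_n),
    [/\ forall j, mxsimpleT (U j), (\sum_j U j :=: 1%:M)%MS
      & mxdirect (\sum_j U j)%MS].

End Semisimple.

End Representations.

Module Grothendieck.
Import freeg.

Section Grothendieck.

Variables (R : fieldType) (gT : finGroupType) (G : {group gT}).

Definition free_group := {freeg {classic representation R G} / int}.

Definition generator (M : representation R G) : free_group :=
  [freeg [:: (1, M : {classic representation R G})]].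

Inductive relation : free_group -> Prop :=
| relation0 : relation 0
| relationB x y : relation x -> relation y -> relation (x - y)
| relation_exact M1 M2 M3 : short_exact M1 M2 M3 ->
    relation (generator M2 - generator M1 - generator M3).

Definition relations : {pred free_group} := fun x => `[< relation x >].

Lemma relations_closed : zmod_closed relations.
Proof.
split=> [|x y /asboolP xr /asboolP yr]; apply/asboolP.
  exact: relation0.
exact: relationB.
Qed.

HB.instance Definition _ :=
  GRing.isZmodClosed.Build free_group relations relations_closed.

(* The free abelian group on the finite-dimensional RG-modules modulo        *)
(* M2 = M1 + M3 for each exact sequence 0 -> M1 -> M2 -> M3 -> 0; isomorphic *)
(* modules are identified by the sequences with M1 = 0 or M3 = 0.            *)
Definition grothendieck_group := {ideal_quot relations}.

#[export] HB.instance Definition _ := GRing.Zmodule.on grothendieck_group.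

Definition grothendieck_class (M : representation R G) : grothendieck_group :=
  (\pi_grothendieck_group (generator M))%qT.

End Grothendieck.

Module Exports. HB.reexport. End Exports.

End Grothendieck.
Export Grothendieck.Exports.

Notation grothendieck_group := Grothendieck.grothendieck_group.
Notation grothendieck_class := Grothendieck.grothendieck_class.

Section Arrangements.

Variables (R : realFieldType) (d : nat).

(* A finite set of linear hyperplanes (a central arrangement); each          *)
(* hyperplane is the kernel of a nonzero linear form, given as a column.     *)
Record arrangement := Arrangement {
  hyp_index : finType;
  normal : hyp_index -> 'cV[R]_d;
  normal_neq0 : forall i, normal i != 0;
  normal_inj : forall i j, (kermx (normal i) :=: kermx (normal j))%MS -> i = j
}.

Variable A : arrangement.
Implicit Types (i : hyp_index A) (v : 'rV[R]_d).

Definition hyperplane i : 'M[R]_d := kermx (normal i).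

Definition essential := (\bigcap_i hyperplane i)%MS = 0.

(* [None]: v lies on H_i; [Some b]: v lies on one of its two open sides. *)
Definition side i v : option bool :=
  let t := (v *m normal i) 0 0 in if t == 0 then None else Some (0 < t).

Definition sides v : {ffun hyp_index A -> option bool} := [ffun i => side i v].

(* Two points are equivalent iff they have the same [sides]; a face is an    *)
(* equivalence class, that is, a nonempty fibre of [sides].                  *)
Record face := Face {
  face_sides :> {ffun hyp_index A -> option bool};
  face_nonempty : `[< exists v, sides v = face_sides >]
}.

HB.instance Definition _ := [isSub for face_sides].
HB.instance Definition _ := [Finite of face by <:].

Lemma sides_nonempty v : `[< exists u, sides u = sides v >].
Proof. by apply/asboolP; exists v. Qed.

Definition face_of v : face := Face (sides_nonempty v).

Definition face_pt (x : face) : 'rV[R]_d := sval (cid (asboolW (face_nonempty x))).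

Lemma face_ptK x : face_of (face_pt x) = x.
Proof. by apply: val_inj; apply: (svalP (cid (asboolW (face_nonempty x)))). Qed.

Lemma face_ofP v v' : face_of v = face_of v' <-> forall i, side i v = side i v'.
Proof.
split=> [/(congr1 face_sides) /ffunP e i|e].
  by have := e i; rewrite !ffunE.
by apply: val_inj; apply/ffunP => i; rewrite !ffunE.
Qed.

Definition side_comp (s t : option bool) := if s is None then t else s.

Lemma small_eps (v w : 'rV[R]_d) :
  exists2 e : R, 0 < e &
    forall i, side i (v + e *: w) = side_comp (side i v) (side i w).
Proof.
have [e e0 He] : exists2 e : R, 0 < e & forall i, i \in enum (hyp_index A) ->
    (v *m normal i) 0 0 != 0 ->
    e * `|(w *m normal i) 0 0| < `|(v *m normal i) 0 0|.
  elim: (enum _) => [|i s [e e0 He]]; first by exists 1; rewrite ?ltr01.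
  set a := (v *m normal i) 0 0; set b := (w *m normal i) 0 0.
  have [a0|a0] := eqVneq a 0.
    exists e => // j; rewrite inE => /predU1P[->|/He //].
    by rewrite -/a a0 eqxx.
  have pa : 0 < `|a| by rewrite normr_gt0.
  have pb : 0 < `|b| + 1 by rewrite ltr_wpDl.
  exists (Num.min e (`|a| / (`|b| + 1))).
    by rewrite lt_min e0 divr_gt0.
  move=> j; rewrite inE => /predU1P[->|/He h] nz; last first.
    apply: le_lt_trans (h nz); apply: ler_wpM2r => //.
    by rewrite ge_min lexx.
  rewrite -/a -/b; apply: (@le_lt_trans _ _ (`|a| / (`|b| + 1) * `|b|)).
    by apply: ler_wpM2r => //; rewrite ge_min lexx orbT.
  rewrite mulrAC ltr_pdivrMr // mulrDr mulr1 ltrDl //.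
exists e => // i; rewrite /side mulmxDl -scalemxAl !mxE.
have := He i (mem_enum _ _).
rewrite !mxE; set a := \sum_j _ ; set b := \sum_j _.
have [->|a0] := eqVneq a 0.
  by move=> _ /=; rewrite add0r mulf_eq0 gt_eqF //= pmulr_rgt0.
move=> /(_ isT) h /=.
have {h} : `|e * b| < `|a| by rewrite normrM (gtr0_norm e0).
rewrite ltr_norml => /andP[h1 h2].
case: (ltrgtP a 0) a0 h1 h2 => // a0 _.
  rewrite ltr0_norm // => h1 h2; have h : a + e * b < 0 by lra.
  by rewrite lt_eqF // ltNge ltW.
rewrite gtr0_norm // => h1 h2; have h : 0 < a + e * b by lra.
by rewrite gt_eqF // h.
Qed.

Lemma face_prod_proof (x y : face) :
  `[< exists v, sides v = [ffun i => side_comp (x i) (y i)] >].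
Proof.
apply/asboolP; have [e _ he] := small_eps (face_pt x) (face_pt y).
exists (face_pt x + e *: face_pt y); apply/ffunP => i; rewrite !ffunE he.
by rewrite -{2}[x]face_ptK -{2}[y]face_ptK !ffunE.
Qed.

Definition face_prod (x y : face) : face := Face (face_prod_proof x y).

(* A chamber is a full-dimensional face: its points span V. *)
Definition chambers : {set face} :=
  [set x | `[< exists2 B : 'M[R]_d, row_full B
               & forall k, face_of (row k B) = x >]].

Definition flat_mx (B : {set hyp_index A}) : 'M[R]_d :=
  <<\bigcap_(i in B) hyperplane i>>%MS.

Definition flat := seq_sub (codom flat_mx).
HB.instance Definition _ := Finite.on flat.
Definition flat_space (X : flat) : 'M[R]_d := ssval X.
Coercion flat_space : flat >-> matrix.

(* The order of the lattice: reverse inclusion. *)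
Definition flat_le (X Y : flat) : bool := (Y <= X)%MS.
Definition flat_lt (X Y : flat) : bool := (Y < X)%MS.

Definition face_sub (x : face) (X : flat) :=
  `[< forall v, face_of v = x -> (v <= X)%MS >].

Definition flat_weight (p : face -> R) (X : flat) : R :=
  \sum_(x | face_sub x X) p x.

Definition interval (X : flat) : {set flat} :=
  [set Y : flat | (X < Y)%MS && (Y < (1%:M : 'M[R]_d))%MS].

(* The simplices of the order complex of (V, X) with k vertices, that is,    *)
(* of dimension k - 1; the empty simplex is included.                        *)
Definition simplices (X : flat) (k : nat) : {set {set flat}} :=
  [set s : {set flat} | [&& s \subset interval X, #|s| == k
    & [forall Y in s, forall Z in s, flat_le Y Z || flat_le Z Y]]].

(* The incidence number of s in t: (-1)^j if s is t minus its j-th element   *)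
(* in the order of the lattice, counting from 0.                             *)
Definition incidence (s t : {set flat}) : R :=
  \sum_(Y in t | t :\ Y == s) (-1) ^+ #|[set Z in t | flat_lt Z Y]|.

(* Cochains are row vectors indexed by simplices, with                       *)
(* (f *m coboundary) t = \sum_j (-1)^j f (t minus its j-th element).         *)
Definition coboundary (X : flat) (k : nat)
    : 'M[R]_(#|simplices X k|, #|simplices X k.+1|) :=
  \matrix_(i, j) incidence (enum_val i) (enum_val j).

Definition cocycles X k : 'M[R]_#|simplices X k| := kermx (coboundary X k).

Definition coboundaries X k : 'M[R]_#|simplices X k| :=
  match k with 0%N => 0 | k'.+1 => <<coboundary X k'>>%MS end.

(* Left multiplication by \sum_x p_x x on RC, in the basis of chambers. *)
Definition walk_mx (p : face -> R) : 'M[R]_#|chambers| :=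
  \matrix_(i, j) \sum_(x | face_prod x (enum_val i) == enum_val j) p x.

Section Action.

Variables (gT : finGroupType) (W : {group gT}).
Variable rW : mx_representation R W d.

Definition preserves :=
  forall g i, g \in W ->
  exists j, (hyperplane i *m rW g :=: hyperplane j)%MS.

Hypothesis presA : preserves.

Lemma act_normal g i : g \in W ->
  exists (j : hyp_index A) (c : R), c != 0 /\ rW g *m normal i = c *: normal j.
Proof.
move=> gW; have gVW : g^-1%g \in W by rewrite groupV.
have [j ej] := presA i gVW; exists j.
set a := rW g *m normal i; set b := normal j.
have kab m (v : 'M[R]_(m, d)) : v *m b = 0 -> v *m a = 0.
  move=> vb; have : (v <= hyperplane i *m rW g^-1%g)%MS.
    by rewrite ej sub_kermx vb.
  case/submxP => D ->; rewrite /a -mulmxA -(mulmxA (hyperplane i)) (mulmxA (rW _) (rW g)).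
  by rewrite -repr_mxM // mulVg repr_mx1 mul1mx mulmx_ker mulmx0.
have /cV0Pn[k bk] : b != 0 by exact: normal_neq0.
pose u : 'rV[R]_d := (b k 0)^-1 *: delta_mx 0 k.
have ub : u *m b = 1%:M.
  rewrite /u -scalemxAl -rowE; apply/matrixP=> x y; rewrite !ord1 !mxE.
  by rewrite mulVf.
have E : a = (u *m a) 0 0 *: b.
  have : (1%:M - b *m u) *m a = 0.
    by apply: kab; rewrite mulmxBl mul1mx -mulmxA ub mulmx1 subrr.
  rewrite mulmxBl mul1mx => /eqP; rewrite subr_eq0 => /eqP {1}->.
  by rewrite -mulmxA [u *m a in LHS]mx11_scalar mul_mx_scalar.
exists ((u *m a) 0 0); split=> //; apply/eqP => c0.
have : a = 0 by rewrite E c0 scale0r.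
move=> /(congr1 (mulmx (rW g^-1%g))).
rewrite mulmx0 /a mulmxA -repr_mxM // mulVg repr_mx1 mul1mx => n0.
by have := normal_neq0 i; rewrite n0 eqxx.
Qed.

Lemma side_act g i : g \in W ->
  exists (j : hyp_index A) (f : bool -> bool),
    forall v, side i (v *m rW g) = omap f (side j v).
Proof.
move=> gW; have [j [c [c0 ej]]] := act_normal i gW.
exists j, (eq_op (0 < c)) => v; rewrite /side -mulmxA ej -scalemxAr mxE.
set t := (v *m _) 0 0; rewrite mulf_eq0 (negPf c0) /=.
case: (ltrgtP t 0) => //= t0; congr Some.
  case: (ltrgtP c 0) c0 => // c1 _; first by rewrite nmulr_rgt0.
  by rewrite pmulr_rgt0 // ltNge ltW.
case: (ltrgtP c 0) c0 => // c1 _; last by rewrite pmulr_rgt0.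
by rewrite nmulr_rgt0 // ltNge ltW.
Qed.

Lemma face_of_act v v' g : g \in W -> face_of v = face_of v' ->
  face_of (v *m rW g) = face_of (v' *m rW g).
Proof.
move=> gW /face_ofP e; apply/face_ofP => i.
by have [j [f ej]] := side_act i gW; rewrite !ej e.
Qed.

Definition face_act_fun (x : face) (g : gT) : face :=
  if g \in W then face_of (face_pt x *m rW g) else x.

Lemma face_act_of v g : g \in W ->
  face_act_fun (face_of v) g = face_of (v *m rW g).
Proof.
by move=> gW; rewrite /face_act_fun gW; apply: face_of_act => //; rewrite face_ptK.
Qed.

Lemma act_fun_proof (S : finType) (to : S -> gT -> S) :
    (forall x g, g \notin W -> to x g = x) -> (forall x, to x 1%g = x) ->
    (forall x, {in W &, act_morph to x}) ->
  is_action W to.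
Proof.
move=> out to1 toM; split=> // g x y.
have [gW|gW] := boolP (g \in W); last by rewrite !out.
move=> /(congr1 (to^~ g^-1%g)).
by rewrite -!toM ?groupV // mulgV !to1.
Qed.

Lemma face_act_proof : is_action W face_act_fun.
Proof.
apply: act_fun_proof => [x g /negPf gW|x|x g h gW hW].
- by rewrite /face_act_fun gW.
- by rewrite -{1}[x]face_ptK face_act_of ?group1 // repr_mx1 mulmx1 face_ptK.
- by rewrite -[x]face_ptK !face_act_of ?groupM // repr_mxM // mulmxA.
Qed.

Definition face_act : action W face := Action face_act_proof.

Lemma chambers_acts : [acts W, on chambers | face_act].
Proof.
apply/subsetP => g gW; rewrite inE gW inE; apply/subsetP => x.
rewrite !inE => /asboolP[B fB eB]; apply/asboolP.
exists (B *m rW g) => [|k].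
  by rewrite row_full_unit unitmx_mul repr_mx_unit // -row_full_unit fB.
by rewrite row_mul -face_act_of // eB.
Qed.

Definition chamber_repr := perm_repr R chambers_acts.

Lemma face_prod_act x y g : g \in W ->
  face_prod (face_act x g) (face_act y g) = face_act (face_prod x y) g.
Proof.
move=> gW; have [e e0 he] := small_eps (face_pt x) (face_pt y).
have -> : face_prod x y = face_of (face_pt x + e *: face_pt y).
  apply: val_inj; apply/ffunP=> i; rewrite !ffunE he.
  by rewrite -{1}[x]face_ptK -{1}[y]face_ptK !ffunE.
rewrite /= face_act_of //; apply: val_inj; apply/ffunP=> i.
have [j [f ej]] := side_act i gW.
by rewrite /face_act_fun gW !ffunE !ej he; case: (side j (face_pt x)).
Qed.

Variable p : face -> R.

Lemma walk_mx_comm :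
    (forall g x, g \in W -> p (face_act x g) = p x) ->
  {in W, forall g, chamber_repr g *m walk_mx p = walk_mx p *m chamber_repr g}.
Proof.
move=> pW; pose F x y := \sum_(z | face_prod z x == y) p z.
apply: (@perm_repr_comm R gT _ _ _ _ _ _ _ _ _ chambers_acts chambers_acts F) => g gW x y; rewrite /F.
rewrite (reindex_inj (act_inj face_act g)) /=.
apply: eq_big => z; last by move=> _; rewrite -/(face_act z g) pW.
by rewrite face_prod_act // (inj_eq (act_inj face_act g)).
Qed.

Lemma eigenspace_module (lam : R) :
    (forall g x, g \in W -> p (face_act x g) = p x) ->
  mxmodule chamber_repr (eigenspace (walk_mx p) lam).
Proof.
move=> pW; apply/mxmoduleP => g gW; apply/eigenspaceP.
rewrite -mulmxA walk_mx_comm // mulmxA.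
by have /eigenspaceP -> := submx_refl (eigenspace (walk_mx p) lam); rewrite scalemxAl.
Qed.


Lemma sub_flat_mxP m (v : 'M[R]_(m, d)) (B : {set hyp_index A}) :
  reflect (forall i, i \in B -> (v <= hyperplane i)%MS) (v <= flat_mx B)%MS.
Proof. by rewrite /flat_mx genmxE; apply: sub_bigcapmxP. Qed.

Lemma flat_genmx (X : flat) : <<X>>%MS = X.
Proof. by case: X => X /= /codomP[B ->]; rewrite /flat_mx genmx_id. Qed.

Lemma flat_act_mem (X : flat) g : g \in W ->
  <<X *m rW g>>%MS \in codom flat_mx.
Proof.
move=> gW; case: X => X /= /codomP[B ->]; set Y := flat_mx B.
apply/codomP; exists [set j | (Y *m rW g <= hyperplane j)%MS].
have gB B' : <<flat_mx B'>>%MS = flat_mx B' by rewrite /flat_mx genmx_id.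
rewrite -[RHS]gB; apply/genmxP/andP; split.
  by apply/sub_flat_mxP => j; rewrite inE.
set v := flat_mx _; have vj j : (Y *m rW g <= hyperplane j)%MS ->
    (v <= hyperplane j)%MS.
  by move=> h; apply: (sub_flat_mxP _ _ (submx_refl v)); rewrite inE.
have -> : v = v *m rW g^-1%g *m rW g.
  by rewrite -mulmxA -repr_mxM ?groupV // mulVg repr_mx1 mulmx1.
apply: submxMr; apply/sub_flat_mxP => i iB.
have [j ej] := presA i gW.
have : (v <= hyperplane i *m rW g)%MS.
  rewrite ej; apply: vj; rewrite -ej; apply: submxMr.
  exact: (sub_flat_mxP _ _ (submx_refl Y)).
move=> /(submxMr (rW g^-1%g)).
by rewrite -(mulmxA (hyperplane i)) -repr_mxM ?groupV // mulgV repr_mx1 mulmx1.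
Qed.

(* The flat X g; the default value of [insubd] is never used. *)
Definition flat_act_fun (X : flat) (g : gT) : flat :=
  if g \in W then insubd X <<X *m rW g>>%MS else X.

Lemma flat_act_funE (X : flat) g : g \in W ->
  flat_act_fun X g = <<X *m rW g>>%MS :> 'M_d.
Proof.
by move=> gW; rewrite /flat_act_fun gW /flat_space insubdK //; apply: flat_act_mem.
Qed.

Lemma flat_act_proof : is_action W flat_act_fun.
Proof.
apply: act_fun_proof => [X g /negPf gW|X|X g h gW hW].
- by rewrite /flat_act_fun gW.
- by apply: val_inj; rewrite [LHS]flat_act_funE // repr_mx1 mulmx1 flat_genmx.
apply: val_inj; rewrite [LHS]flat_act_funE ?groupM //.
rewrite [RHS]flat_act_funE // flat_act_funE // repr_mxM // mulmxA.
by apply/genmxP/eqmxP; apply: eqmxMr; apply: eqmx_sym; apply: genmxE.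
Qed.

Definition flat_act : action W flat := Action flat_act_proof.

Lemma flat_actE X g : g \in W -> (flat_act X g :=: (X : 'M_d) *m rW g)%MS.
Proof. by move=> gW /=; rewrite flat_act_funE //; apply: genmxE. Qed.

Lemma flat_act_le X Y g : g \in W ->
  flat_le (flat_act X g) (flat_act Y g) = flat_le X Y.
Proof.
move=> gW; rewrite /flat_le !flat_actE // submxMfree //.
by rewrite row_free_unit repr_mx_unit.
Qed.

Lemma flat_act_lt X Y g : g \in W ->
  flat_lt (flat_act X g) (flat_act Y g) = flat_lt X Y.
Proof.
move=> gW; rewrite /flat_lt !ltmxE.
by rewrite -!/(flat_le _ _) !flat_act_le.
Qed.

Section Stabilizer.

Variable X : flat.

Definition flat_stab : {group gT} := 'C_W[X | flat_act]%G.

Lemma flat_stab_sub : flat_stab \subset W.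
Proof. exact: subsetIl. Qed.

Lemma flat_stabP g : g \in flat_stab -> g \in W /\ flat_act X g = X.
Proof.
move=> gS; have gW := subsetP flat_stab_sub g gS; split=> //.
by case/setIP: gS => _ /astab_act-> //; rewrite inE.
Qed.

Lemma interval_act Y g : g \in flat_stab ->
  Y \in interval X -> flat_act Y g \in interval X.
Proof.
move=> /flat_stabP[gW eX]; rewrite !inE => /andP[XY Y1]; apply/andP; split.
  by rewrite -/(flat_lt _ _) -eX flat_act_lt.
move: Y1; rewrite !ltmx1 -!sub1mx flat_actE // !sub1mx !row_full_unit.
by rewrite unitmx_mul repr_mx_unit // andbT.
Qed.

Lemma simplices_acts k : [acts flat_stab, on simplices X k | flat_act^*].
Proof.
apply/subsetP => g gS; have [gW _] := flat_stabP gS.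
rewrite inE gW inE; apply/subsetP => s; rewrite !inE.
case/and3P=> /subsetP sX /eqP ks /forall_inP cs; apply/and3P; split.
- apply/subsetP => _ /imsetP[Y Ys ->]; exact: interval_act (sX _ Ys).
- by rewrite card_setact ks.
apply/forall_inP => _ /imsetP[Y Ys ->]; apply/forall_inP => _ /imsetP[Z Zs ->].
by rewrite !flat_act_le //; have /forall_inP := cs Y Ys; apply.
Qed.

Definition simplex_repr k := perm_repr R (simplices_acts k).

Lemma incidence_act s t g : g \in W ->
  incidence (flat_act^* s g)%act (flat_act^* t g)%act = incidence s t.
Proof.
move=> gW; have inj := act_inj flat_act g; set f := flat_act^~ g in inj.
rewrite -[(flat_act^* s g)%act]/(f @: s) -[(flat_act^* t g)%act]/(f @: t).
rewrite /incidence (reindex_inj inj); apply: eq_big => Y.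
  have -> : f @: t :\ f Y = f @: (t :\ Y).
    apply/setP => Z; apply/setD1P/imsetP => [[nZ /imsetP[Z' Z't eZ]]|[Z']].
      by exists Z'; rewrite // !inE Z't andbT; apply: contraNneq nZ => <-; rewrite eZ.
    by rewrite !inE => /andP[nZ Z't] ->; rewrite (inj_eq inj) (mem_imset _ _ inj).
  by rewrite (inj_eq (imset_inj inj)) (mem_imset _ _ inj).
move=> _; congr (_ ^+ _).
rewrite -[RHS](card_imset _ inj); apply: eq_card => Z; apply/setIdP/imsetP.
  case=> /imsetP[Z' Z't ->]; rewrite flat_act_lt // => lt.
  by exists Z'; rewrite ?inE ?Z't.
case=> Z'; rewrite inE => /andP[Z't lt] ->.
by rewrite (mem_imset _ _ inj) flat_act_lt.
Qed.

Lemma coboundary_comm k : {in flat_stab, forall g,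
  simplex_repr k g *m coboundary X k = coboundary X k *m simplex_repr k.+1 g}.
Proof.
apply: (@perm_repr_comm R gT _ _ _ _ _ _ _ _ _ (simplices_acts k)
  (simplices_acts k.+1) incidence) => g gS s t.
by rewrite incidence_act //; case: (flat_stabP gS).
Qed.

Lemma cocycles_module k : mxmodule (simplex_repr k) (cocycles X k).
Proof.
apply/mxmoduleP => g gS; apply/sub_kermxP.
by rewrite -mulmxA coboundary_comm // mulmxA mulmx_ker mul0mx.
Qed.

Lemma coboundaries_module k : mxmodule (simplex_repr k) (coboundaries X k).
Proof.
apply/mxmoduleP => g gS; case: k => [|k] /=; first by rewrite mul0mx sub0mx.
rewrite genmxE (eqmxMr _ (genmxE _)) -coboundary_comm //; exact: submxMl.
Qed.

(* The reduced cohomology in degree k - 1. *)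
Definition reduced_cohomology (k : nat) : representation R flat_stab :=
  Representation (section_repr (coboundaries_module k) (cocycles_module k)).

(* The direct sum over all degrees. For X = V the interval (V, V) is empty   *)
(* and this is the trivial representation, in degree -1.                     *)
Definition total_cohomology : representation R flat_stab :=
  \big[dadd_grepr/grepr0]_(k < #|[set: flat]|.+1) reduced_cohomology k.

Lemma flat_module : mxmodule (subg_repr rW flat_stab_sub) X.
Proof.
by apply/mxmoduleP => g /flat_stabP[gW eX] /=; rewrite -flat_actE // eX.
Qed.

Definition det_quotient : mx_representation R flat_stab 1 :=
  det_repr (factmod_repr flat_module).

Definition flat_summand : representation R W :=
  Representation
    (ind_repr flat_stab_sub (prod_repr total_cohomology det_quotient)).

End Stabilizer.

Definition eigenspace_repr (lam : R)
    (pW : forall g x, g \in W -> p (face_act x g) = p x) : representation R W :=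
  Representation (submod_repr (eigenspace_module lam pW)).

End Action.
End Arrangements.

(* Main.v *)
(* A class in the Grothendieck group over a field of characteristic 0 is
   determined by its character, so it suffices to compute the trace of each g in W
   on each eigenspace of T.

   For a face f one has f a = lambda_f f + (combination of faces f x with larger
   weight lambda), because p >= 0. Hence the product of the T - lambda over the
   distinct weights lambda kills the unit face, T is diagonalizable, and the
   projection onto an eigenspace is a polynomial in T, that is, the action of an
   element b of the face algebra with sum_{x <= X} b_x known for every X.

   The trace of c |-> (x c) g counts the chambers with (x c) g = c. The faces z with
   (x z) g = z correspond to the faces of an arrangement in the fixed space V^g, and
   the Euler relation sum_z (-1)^dim z = (-1)^dim for that arrangement, restricted
   to each g-stable flat X and inverted over the poset of g-stable flats, gives
   sum_{X >= x, X g = X} (-1)^(dim V^g - dim X^g) mu_g(V, X), where mu_g is the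
   Moebius function of the g-stable flats.

   By Folkman's theorem the cohomology of (V, X) lives in one degree, so by the
   Hopf trace formula its character is (-1)^(codim X) mu_g(V, X); and
   (-1)^(codim X) det(g | V/X) = (-1)^(dim (V/X)^g). This matches the summand of X,
   and inducing from the stabilizer sums over an orbit of flats. *)

Require Import Defs.
From HB Require Import structures.
From mathcomp Require Import all_boot all_order all_algebra all_fingroup.
From mathcomp Require Import pgroup mxrepresentation character.
From mathcomp Require Import boolp reals polyrcf complex.
From mathcomp Require Import ring zify.
Import Order.TTheory GRing.Theory Num.Theory.
Local Open Scope ring_scope.

Set Implicit Arguments.
Unset Strict Implicit.
Unset Printing Implicit Defensive.

Local Notation normal := Defs.normal.
Local Notation interval := Defs.interval.

(** * Classes in the Grothendieck group are determined by characters *)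

(** Eigenspaces come without bases, so their characters are read off as traces of projections times
    g. The trace of x g depends on x only through the flats containing x, which is why it suffices
    to know the sums of the coefficients of a projection over the faces inside each flat. The
    obstacle in that trace is that x need not be fixed by g, so a face fixed by z |-> (x z) g need
    not meet V^g. Iterating this map from the unit face, as often as the order of g, gives the
    product f of the translates x g, x g^2, ...; the fixed faces are f times the face of a point of
    V^g, and the Euler relation is stated with some sides frozen so that it applies to them. The
    determinant enters through its sign: nonreal eigenvalues of g pair off and the real ones are 1
    and -1, so (-1)^n det g is (-1) to the dimension of the fixed space. This turns the codimension
    sign of the cohomology into the sign of the Euler relation. *)

Lemma mul_row_col_base_idem (F : fieldType) n (e : 'M[F]_n) :
  e *m e = e -> row_base e *m col_base e = 1%:M.
Proof.
move=> ee; apply: (row_full_inj (col_base_full e)).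
apply: (row_free_inj (row_base_free e)); rewrite mulmx1; have E := mulmx_base e.
transitivity ((col_base e *m row_base e) *m (col_base e *m row_base e)).
  by rewrite !mulmxA.
by rewrite E ee.
Qed.

Lemma mxtrace_idem (F : fieldType) n (e : 'M[F]_n) :
  e *m e = e -> \tr e = (\rank e)%:R.
Proof.
move=> ee; rewrite -{1}(mulmx_base e) mxtrace_mulC.
by rewrite mul_row_col_base_idem // mxtrace1.
Qed.

Lemma mxtrace_lin_mulmx (F : fieldType) m n (B : 'M[F]_m) (C : 'M[F]_n) :
  \tr (lin_mx (mulmx B \o mulmxr C)) = \tr B * \tr C.
Proof.
rewrite /mxtrace (reindex _ (curry_mxvec_bij m n)) /=.
rewrite big_distrlr pair_bigA; apply: eq_bigr => -[i j] _ /=.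
rewrite mxE mxvecE /= vec_mx_delta mulmxA mxE (bigD1 j) //= big1 => [|k nek].
  rewrite addr0 mxE (bigD1 i) //= big1 ?addr0 ?mxE ?eqxx ?mulr1 // => k nek.
  by rewrite mxE (negPf nek) mulr0.
rewrite mxE big1 ?mul0r // => l _.
by rewrite mxE (negPf nek) andbF mulr0.
Qed.

Section Characters.

Variables (F : numFieldType) (gT : finGroupType) (G : {group gT}).
Implicit Types n : nat.

Lemma natr_cardG_neq0 : #|G|%:R != 0 :> F.
Proof. by rewrite pnatr_eq0 -lt0n cardG_gt0. Qed.

(** The average [e] of the group is a projection onto the fixed space, so its trace is its rank. *)
Lemma sum_mxtrace_rfix n (rG : mx_representation F G n) :
  \sum_(g in G) \tr (rG g) = #|G|%:R * (\rank (rfix_mx rG G))%:R.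
Proof.
pose S := \sum_(g in G) rG g.
have Sg g : g \in G -> S *m rG g = S.
  move=> gG; rewrite /S mulmx_suml [RHS](reindex_inj (mulIg g)) /=.
  apply: eq_big => h; first by rewrite groupMr.
  by move=> hG; rewrite repr_mxM.
have fixS m (v : 'M_(m, n)) : (v <= rfix_mx rG G)%MS -> v *m S = #|G|%:R *: v.
  move/rfix_mxP => vG; rewrite /S mulmx_sumr (eq_bigr (fun=> v)) //.
  by rewrite sumr_const scaler_nat.
have SS : S *m S = #|G|%:R *: S by apply: fixS; apply/rfix_mxP => g /Sg.
pose e := #|G|%:R^-1 *: S.
have ee : e *m e = e.
  rewrite /e -scalemxAl -scalemxAr SS !scalerA.
  by rewrite divfK ?natr_cardG_neq0.
have -> : \sum_(g in G) \tr (rG g) = #|G|%:R * \tr e.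
  by rewrite /e mxtraceZ mulrA divff ?natr_cardG_neq0 // mul1r raddf_sum.
rewrite mxtrace_idem //; congr (_ * _%:R); apply/eqmx_rank; apply/andP; split.
  by apply/rfix_mxP => g gG; rewrite /e -scalemxAl Sg.
apply/submxP; exists (rfix_mx rG G).
by rewrite /e -scalemxAr fixS // scalerA mulVf ?natr_cardG_neq0 // scale1r.
Qed.

Section Average.

Variables (n1 n2 : nat).
Variables (r1 : mx_representation F G n1) (r2 : mx_representation F G n2).

(* The projection of Hom(r1, r2) onto the equivariant maps: its rank is its
   trace, which depends only on the two characters. *)
Definition hom_avg_mx : 'M[F]_(n1 * n2) :=
  #|G|%:R^-1 *: \sum_(g in G) lin_mx (mulmx (r1 g^-1%g) \o mulmxr (r2 g)).

Lemma mul_vec_hom_avg (f : 'M[F]_(n1, n2)) :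
  mxvec f *m hom_avg_mx =
  mxvec (#|G|%:R^-1 *: \sum_(g in G) r1 g^-1%g *m f *m r2 g).
Proof.
rewrite /hom_avg_mx -scalemxAr mulmx_sumr linearZ /=; congr (_ *: _).
by rewrite linear_sum; apply: eq_bigr => g _; rewrite mul_vec_lin /= mulmxA.
Qed.

Lemma hom_avg_id (f : 'M[F]_(n1, n2)) :
  {in G, forall g, r1 g *m f = f *m r2 g} -> mxvec f *m hom_avg_mx = mxvec f.
Proof.
move=> fG; rewrite mul_vec_hom_avg; congr mxvec.
rewrite (eq_bigr (fun=> f)) => [|g gG].
  by rewrite sumr_const -scaler_nat scalerA mulVf ?natr_cardG_neq0 // scale1r.
by rewrite -mulmxA -fG // mulmxA -repr_mxM ?groupV // mulVg repr_mx1 mul1mx.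
Qed.

Lemma hom_avg_hom (f : 'M[F]_(n1, n2)) :
  {in G, forall g, r1 g *m vec_mx (mxvec f *m hom_avg_mx)
                     = vec_mx (mxvec f *m hom_avg_mx) *m r2 g}.
Proof.
move=> h hG; rewrite mul_vec_hom_avg mxvecK -scalemxAr -scalemxAl.
congr (_ *: _); rewrite mulmx_sumr mulmx_suml.
rewrite (reindex_inj (mulIg h)) /=; apply: eq_big => g; first by rewrite groupMr.
rewrite groupMr // => gG.
by rewrite !mulmxA -repr_mxM ?groupV ?groupM // invMg mulKVg repr_mxM // mulmxA.
Qed.

Lemma hom_avg_idem : hom_avg_mx *m hom_avg_mx = hom_avg_mx.
Proof.
apply/row_matrixP => i; rewrite row_mul -{1}[row i _]vec_mxK.
rewrite hom_avg_id ?vec_mxK // => g gG.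
by rewrite rowE -[delta_mx 0 i]vec_mxK; apply: hom_avg_hom.
Qed.

Lemma mxtrace_hom_avg :
  \tr hom_avg_mx = #|G|%:R^-1 * \sum_(g in G) \tr (r1 g^-1%g) * \tr (r2 g).
Proof.
rewrite mxtraceZ raddf_sum /=; congr (_ * _); apply: eq_bigr => g _.
exact: mxtrace_lin_mulmx.
Qed.

Lemma hom_avg_neq0 : hom_avg_mx != 0 ->
  exists2 f : 'M[F]_(n1, n2), f != 0 & {in G, forall g, r1 g *m f = f *m r2 g}.
Proof.
case/rowV0Pn => v /submxP[w ->] nz.
exists (vec_mx (w *m hom_avg_mx)); first by rewrite vec_mx_eq0.
by rewrite -[w]vec_mxK; apply: hom_avg_hom.
Qed.

End Average.

Lemma nonzero_hom_of_trace_eq n1 n2 (r1 : mx_representation F G n1)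
    (r2 : mx_representation F G n2) :
    (n1 > 0)%N -> {in G, forall g, \tr (r1 g) = \tr (r2 g)} ->
  exists2 f : 'M[F]_(n1, n2), f != 0 & {in G, forall g, r1 g *m f = f *m r2 g}.
Proof.
move=> n1_gt0 eq12; apply: hom_avg_neq0.
have : \tr (hom_avg_mx r1 r2) = \tr (hom_avg_mx r1 r1).
  by rewrite !mxtrace_hom_avg; congr (_ * _); apply: eq_bigr => g /eq12->.
rewrite !mxtrace_idem ?hom_avg_idem // => /eqP.
rewrite eqr_nat -mxrank_eq0 => /eqP->; rewrite mxrank_eq0; apply/eqP => r0.
have : mxvec (1%:M : 'M[F]_n1) == 0.
  rewrite -(@hom_avg_id _ _ r1 r1) ?r0 ?mulmx0 // => g _.
  by rewrite mulmx1 mul1mx.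
by rewrite mxvec_eq0 -mxrank_eq0 mxrank1 eqn0Ngt n1_gt0.
Qed.

Local Notation cls := grothendieck_class.

Lemma grothendieck_class_exact (M1 M2 M3 : representation F G) :
  short_exact M1 M2 M3 -> cls M2 = cls M1 + cls M3.
Proof.
move=> ex; rewrite /Grothendieck.grothendieck_class.
apply: etrans (Quotient.pi_add _ _ _); apply/eqP.
rewrite -Quotient.idealrBE opprD addrA.
by apply/asboolP; apply: Grothendieck.relation_exact.
Qed.

(** For a zero module the sequence 0 -> M -> M -> M -> 0 is exact, so its class equals its own
    double. *)
Lemma grothendieck_class0 (M : representation F G) : rdegree M = 0%N -> cls M = 0.
Proof.
move=> M0; apply: (addrI (cls M)); rewrite addr0.
rewrite -(@grothendieck_class_exact M M M) //.
exists 0, 0; split=> [g gG|g gG|||]; rewrite ?mulmx0 ?mul0mx //.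
- by rewrite /row_free mxrank0 M0.
- by rewrite /row_full mxrank0 M0.
apply/eqmxP; rewrite sub0mx andTb; apply/rV_subP; rewrite M0 => v _.
by rewrite thinmx0 sub0mx.
Qed.

Lemma grothendieck_class_iso (M N : representation F G)
    (f : 'M_(rdegree M, rdegree N)) :
    row_free f -> row_full f -> {in G, forall g, M g *m f = f *m N g} ->
  cls M = cls N.
Proof.
move=> ff fF fG; pose Z : representation F G := grepr0.
rewrite (@grothendieck_class_exact Z M N) ?(@grothendieck_class0 Z) ?add0r //.
exists 0, f; split=> // [g gG||]; rewrite ?mulmx0 ?mul0mx //.
- by rewrite /row_free mxrank0.
by apply/eqmxP; rewrite sub0mx; move: ff; rewrite -kermx_eq0 => /eqP->; rewrite sub0mx.
Qed.

Lemma mxrank_in_factmod1 n (U : 'M[F]_n) :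
  \rank (in_factmod U 1%:M) = (n - \rank U)%N.
Proof.
apply: (@addIn (\rank U)); rewrite mxrank_in_factmod.
by rewrite (addsmx_idPr (submx1 U)) mxrank1 subnK ?rank_leq_row.
Qed.

Lemma grothendieck_class_subfact n (r : mx_representation F G n) (U : 'M_n)
    (modU : mxmodule r U) :
  cls (Representation r) = cls (Representation (submod_repr modU))
                           + cls (Representation (factmod_repr modU)).
Proof.
apply: grothendieck_class_exact.
exists (val_submod 1%:M), (in_factmod U 1%:M); split=> [g gG|g gG|||] /=.
- by rewrite -val_submodE -[submod_mx _ _]mul1mx val_submodJ.
- by rewrite -in_factmodE -in_factmodJ // mul1mx.
- by rewrite /row_free val_submod1.
- by rewrite /row_full mxrank_in_factmod1 mxrank_coker.
have sub : (val_submod (1%:M : 'M[F]_(\rank U)) <= kermx (in_factmod U 1%:M))%MS.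
  by apply/sub_kermxP; apply/eqP; rewrite -in_factmodE in_factmod_eq0 val_submod1.
apply/eqmxP; rewrite -(mxrank_leqif_eq sub) mxrank_ker mxrank_in_factmod1.
rewrite subKn ?rank_leq_row //.
by rewrite val_submod1.
Qed.

(** First isomorphism theorem. It serves the recursion on classes, the trace of a section V/U, and
    the trace form of rank-nullity for coboundary maps. *)
Lemma rsim_coker_image n1 n2 (r1 : mx_representation F G n1)
    (r2 : mx_representation F G n2) (f : 'M[F]_(n1, n2)) :
    {in G, forall g, r1 g *m f = f *m r2 g} ->
  {modK : mxmodule r1 (kermx f) & {modI : mxmodule r2 <<f>>%MS &
     mx_rsim (factmod_repr modK) (submod_repr modI)}}.
Proof.
move=> fG.
have modK : mxmodule r1 (kermx f).
  apply/mxmoduleP => g gG; apply/sub_kermxP.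
  by rewrite -mulmxA fG // mulmxA mulmx_ker mul0mx.
have modI : mxmodule r2 <<f>>%MS.
  by apply/mxmoduleP => g gG; rewrite genmxE (eqmxMr _ (genmxE _)) -fG // submxMl.
exists modK, modI.
have eqr : \rank (cokermx (kermx f)) = \rank <<f>>%MS.
  by rewrite mxrank_coker mxrank_ker subKn ?rank_leq_row // mxrank_gen.
have sI m (A : 'M_(m, n1)) : (A *m f <= <<f>>)%MS by rewrite genmxE submxMl.
exists (in_submod <<f>>%MS (val_factmod 1%:M *m f)) => //.
  rewrite -kermx_eq0 -submx0; apply/rV_subP => v /sub_kermxP.
  rewrite in_submodE mulmxA -in_submodE => /eqP.
  rewrite in_submod_eq0 => h.
  have : (v *m (val_factmod 1%:M *m f) <= <<f>>%MS :&: <<f>>^C)%MS.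
    by rewrite sub_capmx h mulmxA sI.
  rewrite capmx_compl submx0 mulmxA -val_factmodE => /eqP/sub_kermxP h'.
  have := in_factmod_eq0 (kermx f) (val_factmod v); rewrite h' val_factmodK.
  by move/eqP->; rewrite submx0.
move=> g gG.
rewrite -in_submodJ ?sI // -(mulmxA _ f) -fG //.
pose A := val_factmod (1%:M : 'M_(\rank (cokermx (kermx f)))) *m r1 g.
rewrite (mulmxA _ (r1 g) f) -/A.
(* Passing to the quotient and back changes [A] only by rows in the kernel of [f]. *)
have -> : A *m f = val_factmod (in_factmod (kermx f) A) *m f.
  rewrite -{1}[A](add_sub_fact_mod (kermx f)) mulmxDl.
  by rewrite (sub_kermxP (val_submodP _)) add0r.
by rewrite [in RHS]val_factmodE -[in RHS]mulmxA [RHS]in_submodE -[RHS]mulmxA -in_submodE.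
Qed.

Lemma grothendieck_class_rsim (M N : representation F G) :
  mx_rsim M N -> cls M = cls N.
Proof.
case=> f eqr freef homf; apply: (grothendieck_class_iso freef _ homf).
by rewrite /row_full (eqP freef) eqr.
Qed.

(* A nonzero equivariant f : M -> N exists as soon as M != 0 (compare with
   Hom(M, M)); then [M] = [ker f] + [im f] and [N] = [im f] + [N / im f], so one
   recurses on ker f and N / im f, without decomposing into simple modules. *)
Lemma grothendieck_class_trace (M N : representation F G) :
  {in G, forall g, \tr (M g) = \tr (N g)} -> cls M = cls N.
Proof.
case: M N => n1 r1 [n2 r2] /=.
elim/ltn_ind: n1 => n1 IHn in n2 r1 r2 * => eqt.
have eq_n : n1 = n2.
  by apply/eqP; rewrite -(eqr_nat F) -!mxtrace1 -(repr_mx1 r1) -(repr_mx1 r2) eqt.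
have [n1_0|n1_gt0] := posnP n1.
  by rewrite !grothendieck_class0 //= -eq_n.
have [f nzf homf] := nonzero_hom_of_trace_eq n1_gt0 eqt.
have [modK [modI simI]] := rsim_coker_image homf.
rewrite (grothendieck_class_subfact modK) (grothendieck_class_subfact modI) addrC.
rewrite (grothendieck_class_rsim (simI : mx_rsim (Representation _) (Representation _))).
congr (_ + _); apply: IHn => [|g gG].
  by rewrite mxrank_ker ltn_subLR ?rank_leq_row // -addn1 addnC leq_add2r lt0n mxrank_eq0.
have := mxtrace_sub_fact_mod modI g; rewrite -eqt // -(mxtrace_sub_fact_mod modK).
by rewrite (mxtrace_rsim simI gG) addrC => /addIr.
Qed.

End Characters.

(** * Diagonalizable operators commuting with a representation *)

Section AnnihilatingProduct.

Variables (F : fieldType) (n : nat) (T : 'M[F]_n).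
Implicit Types (s : seq F) (l : F).

Definition prod_sub_scalar s : 'M[F]_n := foldr (fun l M => M *m (T - l%:M)) 1%:M s.
Local Notation ann := prod_sub_scalar.

Lemma comm_mx_prod_sub_scalar A s : A *m T = T *m A -> A *m ann s = ann s *m A.
Proof.
move=> AT; elim: s => [|l s IHs] /=; first by rewrite mulmx1 mul1mx.
rewrite mulmxA IHs -!mulmxA; congr (_ *m _).
by rewrite mulmxBr mulmxBl AT scalar_mxC.
Qed.

Lemma prod_sub_scalar_comm s : ann s *m T = T *m ann s.
Proof. by rewrite comm_mx_prod_sub_scalar. Qed.

Lemma prod_sub_scalar_cat s1 s2 : ann (s1 ++ s2) = ann s2 *m ann s1.
Proof. by elim: s1 => [|l s1 IHs] /=; rewrite ?mulmx1 // IHs mulmxA. Qed.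

Lemma prod_sub_scalar_perm s1 s2 : perm_eq s1 s2 -> ann s1 = ann s2.
Proof.
move=> e12; apply: (catCA_perm_ind (P := fun s => ann s1 = ann s)) e12 _ => //.
move=> a b c ->; rewrite !prod_sub_scalar_cat -!mulmxA; congr (_ *m _).
by rewrite comm_mx_prod_sub_scalar // prod_sub_scalar_comm.
Qed.

Lemma prod_sub_scalar_rem l s : l \in s -> ann s = ann (rem l s) *m (T - l%:M).
Proof. by move=> ls; rewrite (prod_sub_scalar_perm (perm_to_rem ls)). Qed.

Lemma eigenspace_prod_sub_scalar l s m (v : 'M_(m, n)) :
  (v <= eigenspace T l)%MS -> v *m ann s = (\prod_(a <- s) (l - a)) *: v.
Proof.
move/eigenspaceP => vT; elim: s => [|a s IHs] /=; first by rewrite big_nil scale1r mulmx1.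
rewrite mulmxA IHs -scalemxAl mulmxBr vT mul_mx_scalar -scalerBl scalerA.
by rewrite big_cons mulrC.
Qed.

(** T - l maps the sum S of the other eigenspaces onto itself, and by induction it sends the kernel
    K into S. So K can be corrected by elements of S until T - l kills it. *)
Lemma kermx_prod_sub_scalar s : uniq s ->
  (kermx (ann s) <= \sum_(a <- s) eigenspace T a)%MS.
Proof.
elim: s => [|l s IHs] /=.
  by move=> _; apply/rV_subP => v /sub_kermxP; rewrite mulmx1 => ->; rewrite sub0mx.
case/andP=> ls us; set K := kermx _; rewrite big_cons.
set S := (\sum_(a <- s) _)%MS.
have SS : (S <= S *m (T - l%:M))%MS.
  rewrite /S {IHs us K S}; elim: s ls => [|a s IHs]; first by rewrite !big_nil sub0mx.
  rewrite inE negb_or => /andP[la ls]; rewrite !big_cons addsmxMr addsmxS ?IHs //.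
  have := submx_refl (eigenspace T a); move/eigenspaceP => Ea.
  rewrite mulmxBr Ea mul_mx_scalar -scalerBl (eqmx_scale _) //.
  by rewrite subr_eq0 eq_sym.
have: (K *m (T - l%:M) <= S)%MS.
  apply: submx_trans (IHs us); apply/sub_kermxP.
  rewrite -mulmxA comm_mx_prod_sub_scalar ?mulmx_ker //.
  by rewrite mulmxBl mulmxBr scalar_mxC.
move/submx_trans=> /(_ _ _ SS) /submxP[D]; rewrite mulmxA => e.
rewrite -(subrK (D *m S) K) addmx_sub_adds ?submxMl //.
by apply/sub_kermxP; rewrite mulmxBl e subrr.
Qed.

End AnnihilatingProduct.

Section CommutingOperator.

Variables (F : numFieldType) (gT : finGroupType) (G : {group gT}).
Variables (n : nat) (rG : mx_representation F G n) (T : 'M[F]_n).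
Hypothesis TG : {in G, forall g, rG g *m T = T *m rG g}.
Variable s : seq F.
Hypotheses (us : uniq s) (annT : prod_sub_scalar T s = 0).

Lemma sum_eigenspace_full : (1%:M <= \sum_(a <- s) eigenspace T a)%MS.
Proof.
apply: submx_trans (kermx_prod_sub_scalar T us).
by rewrite annT; apply/sub_kermxP; rewrite mulmx0.
Qed.

Lemma eigenspace_mxmodule a : mxmodule rG (eigenspace T a).
Proof.
apply/mxmoduleP => g gG; apply/eigenspaceP; rewrite -mulmxA TG // mulmxA.
by have /eigenspaceP-> := submx_refl (eigenspace T a); rewrite scalemxAl.
Qed.

(** The Lagrange interpolation polynomial at the node [l] among [s], evaluated at [T]. If [l] is not
    in [s], then [rem l s] is [s] and the matrix is 0, in accordance with a zero eigenspace. *)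
Definition eigen_proj l : 'M[F]_n :=
  (\prod_(a <- rem l s) (l - a))^-1 *: prod_sub_scalar T (rem l s).

Lemma eigen_proj_id l m (v : 'M_(m, n)) :
  (v <= eigenspace T l)%MS -> v *m eigen_proj l = v.
Proof.
move=> vl; rewrite /eigen_proj -scalemxAr (eigenspace_prod_sub_scalar _ vl).
rewrite scalerA mulVf ?scale1r // prodf_seq_neq0; apply/allP => a.
by rewrite mem_rem_uniq // inE subr_eq0 eq_sym => /andP[].
Qed.

Lemma eigen_proj_sub l : (eigen_proj l <= eigenspace T l)%MS.
Proof.
apply: scalemx_sub; apply/sub_kermxP; have [ls|ls] := boolP (l \in s).
  by rewrite -prod_sub_scalar_rem.
by rewrite rem_id // annT mul0mx.
Qed.

(** Factor the projection through coordinates on the eigenspace and rotate the trace; the eigenspace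
    is stable under g, so the projection then acts as the identity. *)
Lemma mxtrace_eigen_proj l g : g \in G ->
  \tr (submod_repr (eigenspace_mxmodule l) g) = \tr (eigen_proj l *m rG g).
Proof.
move=> gG; set E := eigenspace T l; set e := eigen_proj l.
rewrite -[e in RHS](in_submodK (eigen_proj_sub l)) val_submodE -mulmxA.
rewrite [RHS]mxtrace_mulC; congr (\tr _).
rewrite {}/e [X in _ = _ *m X]in_submodE [RHS]mulmxA (eigen_proj_id (l := l)) -?in_submodE //.
by rewrite mxmodule_trans ?eigenspace_mxmodule // val_submod1.
Qed.

(** On an eigenspace T is a scalar, so the simple summands given there by Maschke's theorem are also
    simple for T and G together. Over all eigenvalues they span, and a direct subfamily is
    extracted. *)
Lemma mxsemisimpleT_diag : mxsemisimpleT rG T.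
Proof.
have ss a : exists X : {I : finType & I -> 'M[F]_n},
  (forall i, mxsimple rG (tagged X i)) /\ (\sum_i tagged X i :=: eigenspace T a)%MS.
  have : mx_completely_reducible rG (eigenspace T a).
    move: (eigenspace_mxmodule a) (submx1 (eigenspace T a)) => h1 h2.
    apply: mx_reducibleS h1 h2 _; apply: mx_Maschke_pchar.
    by rewrite /pgroup pcharf'_nat pnatr_eq0 -lt0n cardG_gt0.
  move/(mx_reducible_semisimple (eigenspace_mxmodule a)) => h.
  (* [h] holds only under [classically], hence the passage to a boolean goal. *)
  apply/asboolP; apply: h => -[I U W h1 h2 _]; apply/asboolP.
  by exists (Tagged _ U).
have {ss}[X /all_and2[simX sumX]] := choice ss.
pose J : finType := {a : seq_sub s & tag (X (val a))}.
pose U (j : J) := tagged (X (val (tag j))) (tagged j).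
have simU j : mxsimple rG (U j) by apply: simX.
have sumU : (\sum_j U j :=: 1%:M)%MS.
  apply/eqmxP; rewrite submx1; apply: submx_trans sum_eigenspace_full _.
  rewrite big_seq; elim/big_rec: _ => [|a A sa IHA]; first by rewrite sub0mx.
  rewrite addsmx_sub IHA andbT -sumX; apply/sumsmx_subP => i _.
  pose j : J := @existT _ (fun b : seq_sub s => Finite.sort (tag (X (val b)))) (SeqSub sa) i.
  exact: (sumsmx_sup j).
have [K [sumK dxK]] := sum_mxsimple_direct_sub simU sumU.
exists 'I_#|K|, (fun k => U (enum_val k)); split=> [k||].
- have [modU nzU minU] := simU (enum_val k); split=> //.
    apply/andP; split=> //; set a := val (tag (enum_val k)).
    have : (U (enum_val k) <= eigenspace T a)%MS.
      by rewrite -sumX (sumsmx_sup (tagged (enum_val k))).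
    by move/eigenspaceP->; apply: scalemx_sub.
  by move=> V /andP[modV _] VU nzV; apply: minU.
- by rewrite -big_enum_val.
apply/eqP; rewrite /= -(big_enum_val U) -(big_enum_val (fun j => \rank (U j))).
exact/eqP.
Qed.

End CommutingOperator.

(** * The Euler relation for the faces of a subspace *)

Section Sides.

Variables (R : realFieldType) (d : nat) (A : arrangement R d).
Implicit Types (i j : hyp_index A) (u v w : 'rV[R]_d) (X Y Z : flat A).

Lemma side_None i v : (side i v == None) = (v <= hyperplane i)%MS.
Proof.
rewrite /side /hyperplane; case: ifP => [/eqP e|/eqP ne].
  rewrite eqxx; apply/esym/sub_kermxP/matrixP => a b.
  by rewrite !ord1 e mxE.
apply/esym/negbTE/sub_kermxP => e; by rewrite e mxE in ne.
Qed.

Lemma side_Some i v b : side i v = Some b ->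
  if b then 0 < (v *m normal i) 0 0 else (v *m normal i) 0 0 < 0.
Proof.
rewrite /side; case: ltrgtP => //=; first by move=> h [<-].
by move=> h [<-].
Qed.

Lemma side_pos i v : 0 < (v *m normal i) 0 0 -> side i v = Some true.
Proof. by rewrite /side => h; rewrite gt_eqF // h. Qed.

Lemma side_neg i v : (v *m normal i) 0 0 < 0 -> side i v = Some false.
Proof. by rewrite /side => h; rewrite lt_eqF // ltNge ltW. Qed.

Lemma side_zero i v : (v *m normal i) 0 0 = 0 -> side i v = None.
Proof. by rewrite /side => ->; rewrite eqxx. Qed.

Lemma normal_formD i a b u v : ((a *: u + b *: v) *m normal i) 0 0 =
  a * (u *m normal i) 0 0 + b * (v *m normal i) 0 0.
Proof. by rewrite mulmxDl -!scalemxAl !mxE. Qed.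

Lemma side_cone i a b u v : 0 < a -> 0 < b -> side i u = side i v ->
  side i (a *: u + b *: v) = side i u.
Proof.
move=> a0 b0 e; case eu: (side i u) e => [[]|] /esym ev.
- have := side_Some eu; have := side_Some ev => /= h1 h2.
  by apply: side_pos; rewrite normal_formD addr_gt0 ?mulr_gt0.
- have := side_Some eu; have := side_Some ev => /= h1 h2.
  apply: side_neg; rewrite normal_formD -oppr_gt0 opprD -!mulrN.
  by rewrite addr_gt0 // mulr_gt0 // oppr_gt0.
move: eu ev => /eqP; rewrite side_None => eu /eqP; rewrite side_None => ev.
by apply/eqP; rewrite side_None addmx_sub ?scalemx_sub.
Qed.

Lemma sideN i v : side i (- v) = omap negb (side i v).
Proof.
rewrite /side mulNmx mxE oppr_eq0; case: eqP => //= /eqP ne.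
by rewrite oppr_gt0 real_ltNge ?num_real // le_eqVlt eq_sym (negPf ne).
Qed.

Section Euler.

Variables (U : 'M[R]_d) (e : {ffun hyp_index A -> option bool}).
Implicit Types (J : {set hyp_index A}) (s : {ffun hyp_index A -> option bool}).

(** Sides outside [J] are frozen at [e], so that all stages of the induction on [J] share one type.
    With [e] a face f and [J] the hyperplanes containing f, this is the product of f with the face
    of u. *)
Definition sides_on J u : {ffun hyp_index A -> option bool} :=
  [ffun i => if i \in J then side i u else e i].

Definition sides_img J : {set {ffun hyp_index A -> option bool}} :=
  [set s | `[< exists2 u, (u <= U)%MS & sides_on J u = s >]].

(** For [s] in [sides_img J] this is the linear span of the relatively open cone with signs [s], so
    its rank is the dimension of that face. *)
Definition sides_span J s : 'M[R]_d :=
  (U :&: \bigcap_(i in J | s i == None) hyperplane i)%MS.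

Lemma sides_img_onP J s :
  reflect (exists2 u, (u <= U)%MS & sides_on J u = s) (s \in sides_img J).
Proof. by rewrite inE; apply: asboolP. Qed.

Lemma sides_span_sub J s m (B : 'M_(m, d)) :
  reflect ((B <= U)%MS /\ forall i, i \in J -> s i = None -> (B <= hyperplane i)%MS)
    (B <= sides_span J s)%MS.
Proof.
rewrite sub_capmx; apply: (iffP andP) => -[-> h]; split=> //.
  by move=> i iJ /eqP si; move/sub_bigcapmxP: h; apply; rewrite iJ.
by apply/sub_bigcapmxP => i /andP[iJ /eqP si]; apply: h.
Qed.

Definition set_side s j t : {ffun hyp_index A -> option bool} :=
  [ffun i => if i == j then t else s i].

(* If H_j cuts the relatively open cone of sign vector s, then that cone is
   replaced by three faces contributing e - e + e; otherwise it survives as one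
   face spanning the same space. *)
Lemma euler_step J j s : j \notin J -> s \in sides_img J ->
  \sum_(t | set_side s j t \in sides_img (j |: J))
     (-1) ^+ \rank (sides_span (j |: J) (set_side s j t))
  = (-1) ^+ \rank (sides_span J s) :> R.
Proof.
move=> jJ /sides_img_onP[u0 u0U u0s].
have Pt t : reflect (exists2 u, (u <= U)%MS & sides_on J u = s /\ side j u = t)
    (set_side s j t \in sides_img (j |: J)).
  apply: (iffP (sides_img_onP _ _)) => -[u uU].
    move/ffunP => h; exists u => //; split.
      apply/ffunP => i; have := h i; rewrite !ffunE !inE.
      case: eqP => [->|_] //=; rewrite (negPf jJ) => _.
      by rewrite -u0s ffunE (negPf jJ).
    by have := h j; rewrite !ffunE !inE eqxx.
  case=> h1 h2; exists u => //; apply/ffunP => i; rewrite !ffunE !inE.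
  by case: eqP => [->|_] //=; rewrite -h1 ffunE.
set S := sides_span J s.
have inS u : (u <= U)%MS -> sides_on J u = s -> (u <= S)%MS.
  move=> uU us; apply/sides_span_sub; split=> // i iJ.
  by rewrite -us ffunE iJ => /eqP; rewrite side_None.
have spS b : (sides_span (j |: J) (set_side s j (Some b)) :=: S)%MS.
  apply/eqmxP/rV_eqP => v; apply/sides_span_sub/sides_span_sub => -[vU h].
    split=> // i iJ si; apply: h; rewrite ?inE ?iJ ?orbT // ffunE.
    by case: eqP => // eij; rewrite -eij iJ in jJ.
  split=> // i; rewrite ffunE !inE; case: eqP => //= _; exact: h.
have spN : (sides_span (j |: J) (set_side s j None) :=: S :&: hyperplane j)%MS.
  apply/eqmxP/rV_eqP => v; rewrite sub_capmx; apply/sides_span_sub/andP.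
    move=> [vU h]; split; last by apply: h; rewrite ?ffunE ?inE eqxx.
    apply/sides_span_sub; split=> // i iJ si; apply: h; rewrite ?inE ?iJ ?orbT // ffunE.
    by case: eqP => // eij; rewrite -eij iJ in jJ.
  move=> [/sides_span_sub[vU h] vj]; split=> // i; rewrite ffunE !inE.
  case: eqP => [->|] //= _; exact: h.
have [SH|SH] := boolP (S <= hyperplane j)%MS.
  rewrite (bigD1 None) /=; last first.
    apply/Pt; exists u0 => //; split=> //; apply/eqP; rewrite side_None.
    by apply: submx_trans SH; apply: inS.
  rewrite spN (capmx_idPl SH) big1 ?addr0 // => t /andP[/Pt[u uU [us <-]]].
  by rewrite side_None (submx_trans (inS u uU us) SH).
have rS : ((\rank (S :&: hyperplane j)).+1 = \rank S)%N.
  rewrite -(mxrank_mul_ker S (normal j)) -add1n; congr (_ + _)%N; apply/esym/eqP.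
  rewrite eqn_leq (leq_trans (rank_leq_col _)) // lt0n mxrank_eq0.
  by move: SH; rewrite sub_kermx.
have [w wS wj] : exists2 w : 'rV_d, (w <= S)%MS & side j w = Some true.
  have /row_subPn[k] := SH; set w := row k S => wj.
  have wS : (w <= S)%MS by apply: row_sub.
  case sw: (side j w) => [[]|]; first by exists w.
    by exists (- w); rewrite ?eqmx_opp // sideN sw.
  by move/eqP: sw; rewrite side_None (negPf wj).
(* From a point of the cone on H_j, a small step along v in S keeps the signs in [J] and takes the
   side of v at j. *)
have stepP u v : (u <= U)%MS -> sides_on J u = s -> side j u = None -> (v <= S)%MS ->
    exists2 u, (u <= U)%MS & sides_on J u = s /\ side j u = side j v.
  move=> uU us uj vS; have [eps _ h] := small_eps A u v.
  have [vU vh] := sides_span_sub _ _ _ vS.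
  exists (u + eps *: v); first by rewrite addmx_sub ?scalemx_sub.
  split; last by rewrite h uj.
  rewrite -us; apply/ffunP => i; rewrite !ffunE; case: ifP => // iJ.
  rewrite h; case si: (side i u) => //=; apply/eqP; rewrite side_None vh //.
  by rewrite -us ffunE iJ.
have PN_P b : set_side s j None \in sides_img (j |: J) ->
    set_side s j (Some b) \in sides_img (j |: J).
  move=> /Pt[u uU [us uj]]; apply/Pt; case: b.
    by rewrite -wj; apply: (stepP u).
  have -> : Some false = side j (- w) by rewrite sideN wj.
  by apply: (stepP u); rewrite ?eqmx_opp.
have P_PN : set_side s j (Some true) \in sides_img (j |: J) ->
    set_side s j (Some false) \in sides_img (j |: J) ->
    set_side s j None \in sides_img (j |: J).
  move=> /Pt[u uU [us /side_Some/= uj]] /Pt[v vU [vs /side_Some/= vj]].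
  set a := (u *m _) 0 0 in uj; set b := (v *m _) 0 0 in vj.
  have b0 : 0 < - b by rewrite oppr_gt0.
  (* The positive weights -b and a make the form of H_j vanish. *)
  apply/Pt; exists ((- b) *: u + a *: v); first by rewrite addmx_sub ?scalemx_sub.
  split; last by apply: side_zero; rewrite normal_formD -/a -/b; ring.
  rewrite -us; apply/ffunP => i; rewrite !ffunE; case: ifP => // iJ.
  apply: side_cone => //.
  by have := congr1 (fun f : {ffun _} => f i) vs; rewrite -us !ffunE iJ.
have P_ex : exists t, set_side s j t \in sides_img (j |: J).
  by exists (side j u0); apply/Pt; exists u0.
rewrite big_mkcond /= (bigD1 None) // (bigD1 (Some true)) // (bigD1 (Some false)) //=.
rewrite big1 ?addr0; last by case=> [[]|].
rewrite !spS spN -rS exprS.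
have {}P_ex : [|| set_side s j None \in sides_img (j |: J),
    set_side s j (Some true) \in sides_img (j |: J)
    | set_side s j (Some false) \in sides_img (j |: J)].
  by case: P_ex => -[[]|] ->; rewrite ?orbT.
move: (PN_P true) (PN_P false) P_PN P_ex.
case: (_ \in _) => [/(_ isT)-> /(_ isT)-> _ _|_ _].
  by rewrite mulN1r addrA subrr add0r.
case: (_ \in _); case: (_ \in _) => // h _; rewrite ?addr0 ?add0r ?exprS //.
by have := h isT isT.
Qed.

(** Induction on [J]: resetting the side at j to [e j] fibres the sign vectors for [J] over those
    for [J] minus j, and [euler_step] evaluates each fibre. For empty [J] there is one face,
    spanning [U]. *)
Lemma euler_relation J :
  \sum_(s in sides_img J) (-1) ^+ \rank (sides_span J s) = (-1) ^+ \rank U :> R.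
Proof.
have [k] := ubnP #|J|; elim: k => // k IHk in J *.
have [->|[j jJ]] := set_0Vmem J => [_|].
  rewrite (big_pred1 e) => [|s].
    have -> // : (sides_span set0 e :=: U)%MS.
    apply/eqmxP/rV_eqP => v; apply/sides_span_sub/idP => [[]//|vU].
    by split=> // i; rewrite inE.
  apply/sides_img_onP/eqP => [[u _ <-]|->].
    by apply/ffunP => i; rewrite ffunE inE.
  by exists 0; [exact: sub0mx | apply/ffunP => i; rewrite ffunE inE].
rewrite (cardsD1 j) jJ ltnS => /IHk <-.
rewrite -{1 2}(setD1K jJ); set J' := J :\ j.
have jJ' : j \notin J' by rewrite !inE eqxx.
rewrite (partition_big (fun s => set_side s j (e j)) (mem (sides_img J'))) /=; last first.
  move=> s /sides_img_onP[u uU <-]; apply/sides_img_onP; exists u => //.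
  apply/ffunP => i; rewrite !ffunE in_setU1; case: eqP => [->|] //=.
  by rewrite (negPf jJ').
apply: eq_bigr => s sJ'; rewrite -(euler_step jJ' sJ').
have sj : s j = e j by case/sides_img_onP: sJ' => u _ <-; rewrite ffunE (negPf jJ').
rewrite (reindex_onto (set_side s j) (fun s' : {ffun _} => s' j)) /=.
  apply: eq_bigl => t; have -> : set_side s j t j = t by rewrite ffunE eqxx.
  rewrite eqxx andbT; apply/andb_idr => _.
  apply/eqP/ffunP => i; rewrite !ffunE; case: eqP => // ->; by rewrite sj.
move=> s' /andP[_ /eqP <-]; apply/ffunP => i; rewrite !ffunE.
by case: eqP => [->|].
Qed.

End Euler.
End Sides.

(** * Order complexes *)

Section Cochains.

Variables (F : numFieldType) (T : finType) (lt : rel T).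
Hypotheses (lt_irr : irreflexive lt) (lt_trans : transitive lt).
Implicit Types (s t P Q L : {set T}) (x y z : T) (f g : {set T} -> F).

Definition cochain_diff f t : F :=
  \sum_(y in t) (-1) ^+ #|[set z in t | lt z y]| * f (t :\ y).
Local Notation cob := cochain_diff.

Definition comparable_set s := [forall y in s, forall z in s, [|| y == z, lt y z | lt z y]].

Definition chains P k : {set {set T}} :=
  [set s : {set T} | [&& s \subset P, #|s| == k & comparable_set s]].

(** Vanishing of reduced cohomology in degree k - 1, with cochains defined on all sets although only
    their values on chains matter. At k = 0 the sum [cob g set0] is empty, so exactness forces f to
    vanish on the empty chain. *)
Definition exact_at P k := forall f,
  (forall t, t \in chains P k.+1 -> cob f t = 0) ->
  exists g, forall s, s \in chains P k -> f s = cob g s.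

Lemma comparable_setP s :
  reflect {in s &, forall y z, [|| y == z, lt y z | lt z y]} (comparable_set s).
Proof.
apply: (iffP forall_inP) => [h y z ys zs|h y ys]; first by have /forall_inP := h y ys; apply.
by apply/forall_inP => z; apply: h.
Qed.

Lemma strict_asym x y : lt x y -> lt y x = false.
Proof. by move=> xy; apply/negP => /(lt_trans xy); rewrite lt_irr. Qed.

Lemma comparable_setS s t : s \subset t -> comparable_set t -> comparable_set s.
Proof.
move=> /subsetP st /comparable_setP h; apply/comparable_setP => y z /st yt /st.
exact: h.
Qed.

Lemma cochain_diffB f g t : cob (fun s => f s - g s) t = cob f t - cob g t.
Proof. by rewrite /cob -sumrB; apply: eq_bigr => y _; rewrite mulrBr. Qed.

Lemma eq_cochain_diff f g t : (forall y, y \in t -> f (t :\ y) = g (t :\ y)) ->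
  cob f t = cob g t.
Proof. by move=> fg; apply: eq_bigr => y /fg->. Qed.

Lemma card_lt_setD1 t y z : y \in t ->
  #|[set x in t | lt x z]| = (lt y z + #|[set x in t :\ y | lt x z]|)%N.
Proof.
move=> yt; rewrite (cardsD1 y) inE yt /=; congr (_ + _)%N; apply: eq_card => x.
by rewrite !inE andbA.
Qed.

(** Deleting y and z in either order gives the same set with opposite signs, since deleting the
    smaller one lowers the index of the larger by one. So the double sum is its own negative. *)
Lemma cochain_diff_diff f t : comparable_set t -> cob (cob f) t = 0.
Proof.
move/comparable_setP => ct.
pose G y z := (-1) ^+ #|[set x in t | lt x y]| *
   ((-1) ^+ #|[set x in t :\ y | lt x z]| * f (t :\ y :\ z)) : F.
have GC y z : y \in t -> z \in t -> z != y -> G y z = - G z y.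
  move=> yt zt zy; rewrite /G [t :\ z :\ y]setDDl setUC -setDDl.
  rewrite !mulrA -!exprD (card_lt_setD1 y zt) (card_lt_setD1 z yt).
  have := ct y z yt zt; rewrite eq_sym (negPf zy) /= => /orP[] h.
    by rewrite h (strict_asym h) add0n add1n !exprD exprS; ring.
  by rewrite h (strict_asym h) add0n add1n !exprD exprS; ring.
have -> : cob (cob f) t = \sum_(y in t) \sum_(z in t | z != y) G y z.
  apply: eq_bigr => y yt; rewrite mulr_sumr; apply: eq_bigl => z.
  by rewrite !inE andbC.
set S := LHS; have : S = - S.
  rewrite {1}/S (exchange_big_dep (mem t)) /=; last by move=> y z _ /andP[].
  rewrite /S -sumrN; apply: eq_bigr => z zt; rewrite -sumrN.
  apply: eq_big => y; first by rewrite zt eq_sym.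
  by case/and3P => yt _ zy; apply: GC.
by move/eqP; rewrite -addr_eq0 -mulr2n mulrn_eq0 /= => /eqP.
Qed.

(* The sign (-1)^#{z < y} makes s |-> f (y |: s) commute with the differentials up
   to sign, although y sits in the middle of the chain. *)
Lemma cochain_diff_setU1 f y s : y \notin s -> comparable_set (y |: s) ->
  cob f (y |: s) = (-1) ^+ #|[set z in s | lt z y]| *
    (f s - cob (fun r => (-1) ^+ #|[set z in r | lt z y]| * f (y |: r)) s).
Proof.
move=> ys /comparable_setP cs; rewrite /cob big_setU1 //= setU1K // mulrBr.
rewrite (_ : [set z in y |: s | lt z y] = [set z in s | lt z y]); last first.
  by apply/setP => z; rewrite !inE; case: eqP => [->|] //=; rewrite lt_irr andbF.
congr (_ + _); rewrite mulr_sumr -sumrN; apply: eq_bigr => z zs.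
have zy : z != y by apply: contraNneq ys => <-.
have -> : (y |: s) :\ z = y |: (s :\ z).
  by rewrite setDUl; congr (_ :|: _); apply/setDidPl; rewrite disjoints1 inE eq_sym.
rewrite !mulrA -mulNr; congr (_ * _).
rewrite (card_lt_setD1 _ (setU11 y s)) setU1K // (card_lt_setD1 y zs).
set a := (-1) ^+ #|[set x in s :\ z | lt x y]| : F.
have aa : a * a = 1 by rewrite -expr2 sqrr_sign.
set b := (-1) ^+ #|[set x in s | lt x z]|.
have := cs y z (setU11 _ _) (setU1r y zs); rewrite eq_sym (negPf zy) /= => /orP[] h.
  rewrite h (strict_asym h) add0n add1n exprS -/a -/b.
  by transitivity (- (a * a) * b); [rewrite aa|]; ring.
rewrite h (strict_asym h) add0n add1n exprS -/a -/b.
by transitivity ((a * a) * b); [rewrite aa|]; ring.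
Qed.

Lemma chainsP P k s :
  reflect [/\ s \subset P, #|s| = k & comparable_set s] (s \in chains P k).
Proof.
rewrite inE; apply: (iffP and3P) => -[? /eqP ? ?]; split=> //; exact/eqP.
Qed.

(* The long exact sequence of the pair (P, P - y): relative cochains are cochains
   of the link of y, shifted by one. *)
Lemma glue_exact P y k : y \in P -> exact_at (P :\ y) k ->
    (forall k', k = k'.+1 -> exact_at [set z in P | lt z y || lt y z] k') ->
  exact_at P k.
Proof.
move=> yP exP exL f cf; set L := [set z in P | _] in exL.
have [t tP|g0 fg0] := exP f.
  apply: cf; case/chainsP: tP => tP ct cmt; apply/chainsP; split=> //.
  by apply: subset_trans tP _; apply: subD1set.
(* [f1] is a relative cocycle: it vanishes on the chains of size k that avoid [y]. *)
pose f1 s := f s - cob g0 s.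
have cf1 t : t \in chains P k.+1 -> cob f1 t = 0.
  move=> tP; rewrite cochain_diffB cf // cochain_diff_diff ?subr0 //.
  by case/chainsP: tP.
have f10 s : s \in chains P k -> y \notin s -> f1 s = 0.
  move=> /chainsP[sP cs cms] ys; rewrite /f1 fg0 ?subrr //; apply/chainsP; split=> //.
  by rewrite subsetD1 sP.
case: k => [|k] in exP exL cf fg0 cf1 f10 *.
  exists g0 => s sP; apply/eqP; rewrite -subr_eq0; apply/eqP/f10 => //.
  by case/chainsP: sP => _ /cards0_eq -> _; rewrite inE.
pose sg s : F := (-1) ^+ #|[set z in s | lt z y]|.
have [r rL|psi fpsi] := exL k erefl (fun s => sg s * f1 (y |: s)).
  have [rLs cr cmr] := chainsP _ _ _ rL.
  have yr : y \notin r.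
    by apply/negP => /(subsetP rLs); rewrite inE lt_irr andbF.
  have rP : r \subset P by apply: subset_trans rLs _; apply/subsetP => z; rewrite inE => /andP[].
  have cmyr : comparable_set (y |: r).
    apply/comparable_setP => u v; rewrite !inE => /predU1P[->|ur] /predU1P[->|vr].
    - by rewrite eqxx.
    - by move/(subsetP rLs): vr; rewrite inE orbC => /andP[_ /orP[] ->]; rewrite ?orbT.
    - by move/(subsetP rLs): ur; rewrite inE => /andP[_ /orP[] ->]; rewrite ?orbT.
    - by move/comparable_setP: cmr; apply.
  have : cob f1 (y |: r) = 0.
    apply: cf1; apply/chainsP; split=> //; first by rewrite subUset sub1set yP.
    by rewrite cardsU1 yr cr.
  rewrite cochain_diff_setU1 // => /eqP; rewrite mulf_eq0 signr_eq0 /= subr_eq0.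
  rewrite f10 //; first by move/eqP <-.
  by apply/chainsP; split.
(* The primitive [psi] on the link, carried to the chains through [y]; its sign is dictated by
   [cochain_diff_setU1]. *)
pose h s := if y \in s then - (sg (s :\ y) * psi (s :\ y)) else 0.
exists (fun s => g0 s + h s) => s sP.
rewrite -[LHS](subrK (cob g0 s)) -/(f1 s).
have -> : cob (fun s => g0 s + h s) s = cob h s + cob g0 s.
  by rewrite /cob -big_split /=; apply: eq_bigr => z _; rewrite mulrDr addrC.
congr (_ + _); have [ys|ys] := boolP (y \in s); last first.
  rewrite f10 // /cob big1 // => z zs.
  by rewrite /h inE (negPf ys) andbF mulr0.
have [sPs cs cms] := chainsP _ _ _ sP.
rewrite -(setD1K ys); set r := s :\ y.
have yr : y \notin r by rewrite !inE eqxx.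
rewrite cochain_diff_setU1 ?setD1K // {1}/h (negPf yr) sub0r.
rewrite (@eq_cochain_diff _ (fun r => - psi r)); last first.
  move=> z zr; rewrite /h setU11 setU1K ?mulrN ?signrMK //.
  by rewrite inE (negPf yr) andbF.
have -> : cob (fun r => - psi r) r = - cob psi r.
  by rewrite /cob -sumrN; apply: eq_bigr => z _; rewrite mulrN.
rewrite opprK -fpsi /sg ?signrMK ?setD1K //; apply/chainsP; split.
- apply/subsetP => z zr; have zs : z \in s by move: zr; rewrite inE => /andP[].
  rewrite inE (subsetP sPs _ zs) /=; move/comparable_setP: cms => /(_ _ _ zs ys).
  by case: eqP => // zy; rewrite -zy zr in yr.
- by move: cs; rewrite (cardsD1 y) ys => -[].
by apply: comparable_setS cms; apply: subD1set.
Qed.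

Definition acyclic P := forall k, exact_at P k.
Definition le_of x y := (x == y) || lt x y.

Lemma le_of_refl x : le_of x x. Proof. by rewrite /le_of eqxx. Qed.
Lemma le_of_lt_trans x y z : le_of x y -> lt y z -> lt x z.
Proof. by case/predU1P => [->|xy] // /(lt_trans xy). Qed.
Lemma lt_le_of_trans x y z : lt x y -> le_of y z -> lt x z.
Proof. by move=> xy /predU1P[<-|] //; apply: lt_trans. Qed.
Lemma le_of_trans x y z : le_of x y -> le_of y z -> le_of x z.
Proof.
by move=> xy /predU1P[<-|yz] //; rewrite /le_of (le_of_lt_trans xy yz) orbT.
Qed.

(** The contracting homotopy sends f to s |-> f (h |: s); as h is the least element, it carries no
    sign. *)
Lemma cone_acyclic P h : h \in P -> {in P, forall z, le_of h z} -> acyclic P.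
Proof.
move=> hP hmin k f cf.
have cmh s k' : s \in chains P k' -> h \notin s -> h |: s \in chains P k'.+1.
  move=> /chainsP[sP cs cms] hs; apply/chainsP; split.
  - by rewrite subUset sub1set hP.
  - by rewrite cardsU1 hs cs.
  apply/comparable_setP => u v; rewrite !inE => /predU1P[->|us] /predU1P[->|vs].
  - by rewrite eqxx.
  - by have := hmin _ (subsetP sP _ vs); case/predU1P => [->|->]; rewrite ?eqxx ?orbT.
  - by have := hmin _ (subsetP sP _ us); case/predU1P => [->|->]; rewrite ?eqxx ?orbT.
  - by move/comparable_setP: cms; apply.
have lth s : s \subset P -> #|[set z in s | lt z h]| = 0%N.
  move=> sP; apply: eq_card0 => z; rewrite inE; apply/negP => /andP[zs zh].
  by have := le_of_lt_trans (hmin _ (subsetP sP _ zs)) zh; rewrite lt_irr.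
have key s k' g : s \in chains P k' -> h \notin s ->
    cob g (h |: s) = g s - cob (fun r => g (h |: r)) s.
  move=> sP hs; rewrite cochain_diff_setU1 //; last by case/chainsP: (cmh _ _ sP hs).
  have sPs : s \subset P by case/chainsP: sP.
  rewrite lth // mul1r; congr (_ - _); apply: eq_bigr => z zs.
  by rewrite lth ?mul1r // (subset_trans _ sPs) // subD1set.
exists (fun s => if h \in s then 0 else f (h |: s)) => s sP.
have [hs|hs] := boolP (h \in s); last first.
  have := cf _ (cmh _ _ sP hs); rewrite (key _ _ _ sP hs) => /eqP; rewrite subr_eq0.
  move/eqP->; apply: eq_cochain_diff => z zs.
  by rewrite inE (negPf hs) andbF.
have [sPs cs cms] := chainsP _ _ _ sP.
have hr : h \notin s :\ h by rewrite !inE eqxx.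
have rP : s :\ h \in chains P #|s :\ h|.
  apply/chainsP; split=> //; first exact: subset_trans (subD1set _ _) sPs.
  by apply: comparable_setS cms; apply: subD1set.
rewrite -{2}(setD1K hs) (key _ _ _ rP hr) (negPf hr) setD1K //.
rewrite {1}/cob big1 ?subr0 // => z _; by rewrite setU11 mulr0.
Qed.

(* z <= z v h >= h contracts P onto the cone over h; the contraction is realized
   by removing minimal elements not above h, whose links P_{>z} have base point
   z v h. *)
Lemma join_acyclic P h : h \in P ->
    {in P, forall z, exists j, [/\ j \in P, le_of z j, le_of h j
       & {in P, forall w, le_of z w -> le_of h w -> le_of j w}]} ->
  acyclic P.
Proof.
have [n] := ubnP #|[set z in P | ~~ le_of h z]|.
elim: n => // n IHn in P h *; rewrite ltnS => leN hP joinP.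
have [N0|[z1 z1N]] := set_0Vmem [set z in P | ~~ le_of h z].
  apply: (cone_acyclic hP) => z zP; apply/negPn/negP => nhz.
  by have : z \in set0 by [rewrite -N0 inE zP]; rewrite inE.
have [z0 /andP[z0P nhz0] z0min] : exists2 z0, (z0 \in P) && ~~ le_of h z0 &
    {in P, forall z, lt z z0 -> le_of h z}.
  have [z0 z0N zmin] := @arg_minnP _ z1 (mem [set z in P | ~~ le_of h z])
     (fun z => #|[set w in P | lt w z]|) z1N.
  exists z0; first by move: z0N; rewrite /= inE.
  move=> z zP zz0; apply/negPn/negP => nhz.
  have := zmin z; rewrite /= inE zP nhz => /(_ isT); rewrite leqNgt => /negP; apply.
  apply: proper_card; apply/properP; split.
    by apply/subsetP => w; rewrite !inE => /andP[-> /lt_trans]; apply.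
  by exists z; rewrite inE ?zP ?zz0 ?lt_irr ?andbF.
have hz0 : h != z0 by apply: contraNneq nhz0 => ->; apply: le_of_refl.
move=> k; apply: (glue_exact z0P).
  apply: (IHn _ h).
  - apply: leq_trans leN; apply: proper_card; apply/properP; split.
      by apply/subsetP => w; rewrite !inE => /andP[/andP[_ ->]].
    by exists z0; rewrite !inE ?z0P ?eqxx.
  - by rewrite !inE hz0.
  move=> z; rewrite !inE => /andP[zz0 zP]; have [j [jP zj hj jmin]] := joinP z zP.
  exists j; split=> //; last by move=> w; rewrite !inE => /andP[_]; apply: jmin.
  by rewrite !inE jP andbT; apply: contraNneq nhz0 => <-.
(* Nothing lies below [z0]: by minimality it would be above [h], and then [z0] would be too. *)
move=> k' _; have -> : [set z in P | lt z z0 || lt z0 z] = [set z in P | lt z0 z].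
  apply/setP => z; rewrite !inE; case zP: (z \in P) => //=.
  case zz0: (lt z z0) => //=; case/negP: nhz0.
  by rewrite /le_of (le_of_lt_trans (z0min z zP zz0) zz0) orbT.
have [h' [h'P z0h' hh' h'min]] := joinP z0 z0P.
have z0h'lt : lt z0 h'.
  by case/predU1P: z0h' => // e; rewrite -e (negPf nhz0) in hh'.
(* Whatever is above both [z0] and [h] is above [h'], so no new element enters the count, and [z0]
   leaves it. *)
apply: (IHn _ h').
- apply: leq_trans leN; apply: proper_card; apply/properP; split.
    apply/subsetP => w; rewrite !inE => /andP[/andP[wP z0w] nh'w]; rewrite wP /=.
    by apply: contra nh'w => hw; apply: h'min => //; rewrite /le_of z0w orbT.
  by exists z0; rewrite !inE ?z0P ?lt_irr ?andbF.
- by rewrite inE h'P.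
move=> z; rewrite inE => /andP[zP z0z]; have [j [jP zj hj jmin]] := joinP z zP.
exists j; split=> //.
- by rewrite inE jP (lt_le_of_trans z0z).
- by apply: h'min => //; rewrite /le_of (lt_le_of_trans z0z) ?orbT.
move=> w; rewrite inE => /andP[wP z0w] zw h'w; apply: jmin => //.
exact: le_of_trans hh' h'w.
Qed.

(** The elements of [M] are glued one at a time; in an antichain, removing one element does not
    alter the link of another. *)
Lemma glue_antichain_exact P (M : {set T}) k :
    M \subset P -> {in M &, forall y z, ~~ lt y z} ->
    exact_at (P :\: M) k ->
    (forall y k', y \in M -> k = k'.+1 ->
       exact_at [set z in P | lt z y || lt y z] k') ->
  exact_at P k.
Proof.
have [n] := ubnP #|M|; elim: n => // n IHn in M P *; rewrite ltnS => leM MP anti exD exL.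
have [M0|[y yM]] := set_0Vmem M; first by move: exD; rewrite M0 setD0.
apply: (@glue_exact P y); [exact: (subsetP MP) | | by move=> k'; apply: exL].
apply: (IHn (M :\ y)).
- by apply: leq_trans leM; rewrite [X in (_ < X)%N](cardsD1 y) yM.
- exact: setSD.
- by move=> u v; rewrite !inE => /andP[_ uM] /andP[_ vM]; apply: anti.
- have -> // : (P :\ y) :\: (M :\ y) = P :\: M.
  apply/setP => z; rewrite !inE; case: eqP => [->|] //=; by rewrite yM.
move=> u k'; rewrite !inE => /andP[uy uM] ek.
have -> : [set z in P :\ y | lt z u || lt u z] = [set z in P | lt z u || lt u z].
  apply/setP => z; rewrite !inE; case: eqP => [->|] //=.
  by rewrite (negPf (anti _ _ yM uM)) (negPf (anti _ _ uM yM)) andbF.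
exact: exL ek.
Qed.

End Cochains.

(** * Cohomology of the intervals of the intersection lattice *)

Section Flats.

Variables (R : realFieldType) (d : nat) (A : arrangement R d).
Implicit Types (i : hyp_index A) (X Y Z : flat A) (B : {set hyp_index A}).

Lemma flat_eqmx_inj X Y : (X :=: Y)%MS -> X = Y.
Proof.
by move=> e; apply: val_inj; rewrite -[LHS]flat_genmx -[RHS]flat_genmx; apply/eq_genmx.
Qed.

Definition flat_of B : flat A := SeqSub (codom_f (@flat_mx R d A) B).

Lemma flat_ofP m (v : 'M_(m, d)) B :
  reflect (forall i, i \in B -> (v <= hyperplane i)%MS) (v <= flat_of B)%MS.
Proof. exact: sub_flat_mxP. Qed.

Lemma flat_surj X : exists B, X = flat_of B.
Proof.
have /codomP[B e] := ssvalP X; exists B; apply: val_inj; exact: e.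
Qed.

Lemma flat_capP X Y : exists Z, (Z :=: X :&: Y)%MS.
Proof.
have [[B ->] [C ->]] := (flat_surj X, flat_surj Y); exists (flat_of (B :|: C)).
apply/eqmxP/rV_eqP => v; rewrite sub_capmx; apply/flat_ofP/andP.
  by move=> h; split; apply/flat_ofP => i ii; apply: h; rewrite inE ii ?orbT.
by case=> /flat_ofP hB /flat_ofP hC i; rewrite inE => /orP[/hB|/hC].
Qed.

Lemma flat_lt_irr : irreflexive (@flat_lt R d A).
Proof. by move=> X; rewrite /flat_lt ltmx_irrefl. Qed.

Lemma flat_lt_trans : transitive (@flat_lt R d A).
Proof. by move=> Y X Z XY YZ; apply: ltmx_trans YZ XY. Qed.

Lemma flat_leE X Y : flat_le X Y = le_of (@flat_lt R d A) X Y.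
Proof.
rewrite /flat_le /le_of /flat_lt; apply/idP/predU1P => [YX|[->|/ltmxW] //].
have [XY|nXY] := boolP (X <= Y)%MS; last by right; rewrite ltmxE YX.
by left; apply: flat_eqmx_inj; apply/eqmxP; rewrite XY.
Qed.

Lemma flat_lt_rank X Y : flat_lt X Y -> (\rank Y < \rank X)%N.
Proof. by move/rank_ltmx. Qed.

Lemma simplicesE X k : simplices X k = chains (@flat_lt R d A) (interval X) k.
Proof.
have E (s : {set flat A}) : [forall Y in s, forall Z in s, flat_le Y Z || flat_le Z Y]
  = comparable_set (@flat_lt R d A) s.
  apply/forall_inP/forall_inP => h Y Ys; apply/forall_inP => Z Zs.
    have /forall_inP/(_ Z Zs) := h Y Ys.
    by rewrite !flat_leE /le_of (eq_sym Z); case: eqP => //= _; rewrite orbF.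
  have /forall_inP/(_ Z Zs) := h Y Ys.
  by rewrite !flat_leE /le_of (eq_sym Z); case: eqP => //= _; rewrite orbF.
apply/setP => s; rewrite /simplices /chains.
by rewrite [LHS]in_set [RHS]in_set E.
Qed.

Lemma interval_ltmx X Y : Y \in interval X -> (X < Y)%MS /\ (Y < (1%:M : 'M[R]_d))%MS.
Proof. by rewrite inE => /andP. Qed.

(* Folkman's theorem. Fix a hyperplane H containing X. The flats Y with
   Y cap H <> X form an acyclic poset by [join_acyclic]; the others cover X, and
   their links are the intervals (V, Y), to which induction applies. *)
Lemma flat_interval_exact X k : ~~ row_full X -> k.+1 != (d - \rank X)%N ->
  exact_at R (@flat_lt R d A) (interval X) k.
Proof.
have [n] := ubnP (d - \rank X)%N; elim: n => // n IHn in X k *.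
rewrite ltnS => leX nfX nk.
have [B XB] := flat_surj X.
have [i iB] : exists i, i \in B.
  have [B0|//] := set_0Vmem B; last by case=> i; exists i.
  case/negP: nfX; rewrite XB -sub1mx; apply/flat_ofP => i; by rewrite B0 inE.
have XH : (X <= flat_of [set i])%MS.
  apply/flat_ofP => j /set1P->; have := submx_refl X; rewrite {2}XB.
  by move/flat_ofP; apply.
set H := flat_of [set i] in XH.
have rkH : (\rank H).+1 = d.
  have -> : \rank H = \rank (hyperplane i).
    apply/eqmx_rank/andP; split; first by apply: (flat_ofP _ _ (submx_refl H)); rewrite inE.
    by apply/flat_ofP => j /set1P->.
  rewrite mxrank_ker; have := normal_neq0 i; rewrite -mxrank_eq0.
  have := rank_leq_col (normal i); have := rank_leq_row (normal i).
  by move=> *; lia.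
have cvx Y : Y \in interval X -> ~~ row_full Y.
  by case/interval_ltmx=> _; rewrite ltmx1.
(* If X = H, the interval is empty and its only chain has size 0, the value of k excluded by
   [nk]. *)
have [HX|HX] := boolP (H <= X)%MS.
  have rX : \rank X = \rank H by apply/eqmx_rank; rewrite XH HX.
  have P0 : interval X = set0.
    apply/setP => Y; rewrite [RHS]inE; apply/negP => /interval_ltmx[XY Y1].
    have := rank_ltmx XY; have := rank_ltmx Y1.
    rewrite mxrank1 rX -[X in (_ < X)%N]rkH ltnS.
    by move=> h1 h2; have := leq_ltn_trans h1 h2; rewrite ltnn.
  move=> f _; exists f => s /chainsP[]; rewrite P0 subset0 => /eqP->; rewrite cards0.
  by move=> k0; move: nk; rewrite -k0 rX -{1}rkH subSnn.
have HI : H \in interval X.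
  rewrite inE ltmxE XH HX ltmx1 /row_full neq_ltn; move: (leqnn (\rank H).+1).
  by rewrite [X in (_ <= X)%N -> _]rkH => ->.
pose M := [set Y : flat A in interval X | (Y :&: H <= X)%MS].
have rM Y : Y \in M -> \rank Y = (\rank X).+1.
  rewrite inE => /andP[/interval_ltmx[XY Y1] YHX].
  apply/eqP; rewrite eqn_leq rank_ltmx // andbT.
  have := mxrank_sum_cap Y H; have := mxrankS YHX; have := rank_leq_col (Y + H)%MS.
  by move: rkH; clear; lia.
apply: (@glue_antichain_exact _ _ _ flat_lt_irr flat_lt_trans _ M).
- by apply/subsetP => Y; rewrite inE => /andP[].
- move=> Y Z YM ZM; apply/negP => /flat_lt_rank; by rewrite (rM Y YM) (rM Z ZM) ltnn.
- apply: (@join_acyclic _ _ _ flat_lt_irr flat_lt_trans _ H).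
    rewrite in_setD HI andbT inE HI /=.
    by apply: contra HX; apply: submx_trans; rewrite sub_capmx submx_refl.
  (* Under reverse inclusion the join of Y and H is their intersection; it stays strictly above X as
     a subspace because Y is not in [M]. *)
  move=> Y; rewrite inE => /andP[YM YX]; have [J eJ] := flat_capP Y H.
  have JXn : ~~ ((Y : flat A) :&: H <= X)%MS by move: YM; rewrite inE YX.
  have [XY Y1] := interval_ltmx YX.
  have XJ : (X <= J)%MS by rewrite eJ sub_capmx XH ltmxW.
  exists J; split.
  - rewrite inE [J \in M]inE; apply/andP; split.
      rewrite negb_and; apply/orP; right.
      apply: contra JXn; apply: submx_trans; by rewrite sub_capmx eJ submx_refl capmxSr.
    rewrite inE ltmxE XJ eJ JXn /=; apply: sub_ltmx_trans Y1; by rewrite ?eJ capmxSl.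
  - have : flat_le Y J by rewrite /flat_le eJ capmxSl.
    by rewrite flat_leE; apply.
  - have : flat_le H J by rewrite /flat_le eJ capmxSr.
    by rewrite flat_leE; apply.
  move=> Z _ YZ HZ; have : flat_le J Z; last by rewrite flat_leE; apply.
  have hY : flat_le Y Z by rewrite flat_leE; apply: YZ.
  have hH : flat_le H Z by rewrite flat_leE; apply: HZ.
  by rewrite /flat_le eJ sub_capmx; apply/andP; split.
move=> Y k' YM ek.
have [YI YHX] : Y \in interval X /\ ((Y : flat A) :&: H <= X)%MS.
  by move: YM; rewrite inE => /andP.
have [XY Y1] := interval_ltmx YI.
(* No flat fits strictly between Y and X, so the link is (V, Y). Both k and the codimension then
   drop by one, which preserves the excluded degree. *)
have -> : [set Z in interval X | flat_lt Z Y || flat_lt Y Z] = interval Y.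
  apply/setP => Z; rewrite !inE /flat_lt; apply/idP/idP.
    case/andP=> /andP[XZ Z1] /orP[-> // | ZY].
    have := rank_ltmx ZY; rewrite (rM Y YM) ltnS => /(leq_trans (rank_ltmx XZ)).
    by rewrite ltnn.
  by case/andP=> YZ Z1; rewrite (ltmx_trans XY YZ) Z1 YZ.
apply: IHn; rewrite ?cvx // ?(rM Y YM) //.
  by move: leX (rank_ltmx Y1); rewrite mxrank1 (rM Y YM); clear; lia.
by move: nk (rank_ltmx Y1); rewrite ek mxrank1 (rM Y YM); clear; lia.
Qed.

End Flats.

(** * Characters of the cohomology *)

Section Traces.
Variables (F : numFieldType) (gT : finGroupType) (G : {group gT}).

Lemma mxtrace_dim0 (n : nat) (B : 'M[F]_n) : n = 0%N -> \tr B = 0.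
Proof. by move=> n0; move: B; rewrite n0 => B; rewrite flatmx0 mxtrace0. Qed.

Lemma mxtrace_dadd (I : Type) (r : seq I) (P : pred I) (M : I -> representation F G) g :
  \tr ((\big[dadd_grepr/grepr0]_(i <- r | P i) M i) g) = \sum_(i <- r | P i) \tr (M i g).
Proof.
elim/big_rec2: _ => [|i c N _ IH]; first by rewrite /= mxtrace1.
by rewrite /= mxtrace_block IH.
Qed.

Lemma mxtrace_submod_eq n (r : mx_representation F G n) (U V : 'M_n)
    (modU : mxmodule r U) (modV : mxmodule r V) g : (U :=: V)%MS -> g \in G ->
  \tr (submod_repr modU g) = \tr (submod_repr modV g).
Proof. by move=> eUV; apply: mxtrace_rsim; apply/mx_rsim_iso/eqmx_iso. Qed.

(** The map from V to the quotient by U has kernel U and image the section V/U. *)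
Lemma mxtrace_section n (r : mx_representation F G n) (U V : 'M_n)
    (modU : mxmodule r U) (modV : mxmodule r V) g : (U <= V)%MS -> g \in G ->
  \tr (submod_repr modV g) = \tr (submod_repr modU g) + \tr (section_repr modU modV g).
Proof.
move=> UV gG; pose f := in_factmod U (val_submod (1%:M : 'M_(\rank V))).
have homf : {in G, forall g, submod_repr modV g *m f = f *m factmod_repr modU g}.
  move=> h hG; rewrite /f -in_factmodJ // -(val_submodJ modV) // mul1mx.
  by rewrite /in_factmod /= mulmxA -val_submodE.
have [modK [modI simI]] := rsim_coker_image homf.
rewrite -(mxtrace_sub_fact_mod modK); congr (_ + _).
  have [modU' simU] := mx_rsim_in_submod modU modV UV.
  rewrite (mxtrace_rsim simU gG); apply: mxtrace_submod_eq => //.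
  apply/eqmxP/rV_eqP => w; rewrite genmxE.
  have -> : (w <= in_submod V U)%MS = (val_submod w <= U)%MS.
    by rewrite -[LHS]val_submodS in_submodK.
  rewrite sub_kermx -in_factmod_eq0 /f /in_factmod /=.
  by rewrite mulmxA -val_submodE.
rewrite (mxtrace_rsim simI gG); apply: mxtrace_submod_eq => //.
apply/eqmxP; rewrite !genmxE /f /in_factmod /=.
by rewrite !(eqmxMr _ (val_submod1 V)) submx_refl.
Qed.

End Traces.

Section Cohomology.

Variables (R : realFieldType) (d : nat) (A : arrangement R d).
Variables (gT : finGroupType) (W : {group gT}) (rW : mx_representation R W d).
Variable presA : preserves A rW.
Implicit Types (X Y : flat A) (k : nat).

Lemma mul_coboundary X k (f : {set flat A} -> R) j :
  ((\row_i f (enum_val i)) *m coboundary X k) 0 j =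
  cochain_diff (@flat_lt R d A) f (enum_val j).
Proof.
set t := enum_val j; have tS : t \in simplices X k.+1 := enum_valP j.
rewrite mxE (eq_bigr (fun i => f (enum_val i) * incidence (enum_val i) t)); last first.
  by move=> i _; rewrite !mxE.
rewrite -(big_enum_val (fun s => f s * incidence s t)) /=.
rewrite /incidence; under eq_bigr do rewrite mulr_sumr.
rewrite (exchange_big_dep (mem t)) /=; last by move=> s Y _ /andP[].
apply: eq_bigr => Y Yt; rewrite (big_pred1 (t :\ Y)) 1?mulrC // => s /=.
rewrite Yt /= eq_sym andbC; case: eqP => //= ->.
move: tS; rewrite simplicesE => /chainsP[tS ct cmt]; rewrite simplicesE; apply/chainsP.
split; last exact: comparable_setS (subD1set _ _) cmt.
  exact: subset_trans (subD1set _ _) tS.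
by move: ct; rewrite (cardsD1 Y) Yt => -[].
Qed.

Lemma row_of_cochain X k (v : 'rV[R]_#|simplices X k|) :
  exists f : {set flat A} -> R, v = \row_i f (enum_val i).
Proof.
exists (fun s => \sum_(i < #|simplices X k| | enum_val i == s) v 0 i).
apply/rowP => i; rewrite mxE (big_pred1 i) // => j.
by rewrite (inj_eq enum_val_inj).
Qed.

Lemma cocycles_sub_coboundaries X k : ~~ row_full X -> k.+1 != (d - \rank X)%N ->
  (cocycles X k <= coboundaries X k)%MS.
Proof.
move=> nfX nk; apply/rV_subP => v /sub_kermxP v0.
have [f vf] := row_of_cochain v.
have [|g fg] := flat_interval_exact nfX nk (f := f).
  move=> t; rewrite -simplicesE => tS.
  have := mul_coboundary f (enum_rank_in tS t); rewrite enum_rankK_in // => <-.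
  by rewrite -vf v0 mxE.
have {}vf : v = \row_i cochain_diff (@flat_lt R d A) g (enum_val i).
  by rewrite vf; apply/rowP => i; rewrite !mxE fg // -simplicesE enum_valP.
case: k => [|k] in v v0 f vf fg nk *.
  rewrite (_ : v = 0) ?sub0mx // vf; apply/rowP => i; rewrite !mxE.
  have := enum_valP i; move: (enum_val i) => s.
  rewrite simplicesE => /chainsP[_ /cards0_eq -> _].
  by rewrite /cochain_diff big_set0.
rewrite /= genmxE; apply/submxP; exists (\row_i g (enum_val i)).
by rewrite vf; apply/rowP => i; rewrite mul_coboundary mxE.
Qed.

Lemma coboundary_coboundary X k : coboundary X k *m coboundary X k.+1 = 0.
Proof.
apply/row_matrixP => i; rewrite row_mul row0.
have [f ef] : exists f : {set flat A} -> R, row i (coboundary X k) =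
    (\row_i f (enum_val i)) *m coboundary X k.
  have [f ef] := row_of_cochain (delta_mx 0 i); exists f.
  by rewrite -ef -rowE.
rewrite {}ef; have -> : (\row_i f (enum_val i)) *m coboundary X k =
    \row_i cochain_diff (@flat_lt R d A) f (enum_val i).
  by apply/rowP => j; rewrite mul_coboundary mxE.
apply/rowP => j; rewrite mul_coboundary mxE.
rewrite (cochain_diff_diff (@flat_lt_irr R d A) (@flat_lt_trans R d A)) //.
by have := enum_valP j; move: (enum_val j) => s; rewrite simplicesE => /chainsP[].
Qed.

Lemma coboundaries_sub_cocycles X k : (coboundaries X k <= cocycles X k)%MS.
Proof.
case: k => [|k]; first by rewrite sub0mx.
by rewrite /= genmxE; apply/sub_kermxP/coboundary_coboundary.
Qed.

Lemma mxtrace_perm_repr (S : finType) (D H : {group gT}) (to : action D S)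
    (B : {set S}) (nB : [acts H, on B | to]) g :
  \tr (perm_repr R nB g) = \sum_(x in B) (to x g == x)%:R.
Proof. by rewrite big_enum_val; apply: eq_bigr => i _; rewrite mxE. Qed.

Definition fixed_euler X (g : gT) : R :=
  \sum_(k < #|[set: flat A]|.+1) (-1) ^+ k *
    \sum_(s in simplices X k) (((flat_act presA)^* s g)%act == s)%:R.

(** Philip Hall's formula for mu_g(V, X) when X is g-stable: a chain with k elements counts
    (-1)^(k-1), whereas [fixed_euler] uses (-1)^k. For X = V the empty interval would give -1, so mu
    = 1 is set apart. *)
Definition fixed_moebius X (g : gT) : R := if row_full X then 1 else - fixed_euler X g.

Lemma simplices_big X k : (#|[set: flat A]| < k)%N -> simplices X k = set0.
Proof.
move=> Nk; rewrite simplicesE; apply/setP => s; rewrite [RHS]inE.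
apply/negP => /chainsP[_ sk _]; move: Nk; rewrite -sk ltnNge subset_leq_card //.
Qed.

Lemma simplices_full X k : row_full X -> k != 0%N -> simplices X k = set0.
Proof.
move=> fX k0; apply/setP => s; rewrite simplicesE [RHS]inE.
apply/negP => /chainsP[sX sk _]; have : #|s| != 0%N by rewrite sk.
rewrite cards_eq0 => /set0Pn[Y /(subsetP sX) /interval_ltmx[XY]].
rewrite ltmx1 -sub1mx => /negP; apply; apply: submx_trans (ltmxW XY).
by rewrite sub1mx.
Qed.

Lemma simplices0 X : simplices X 0 = [set set0].
Proof.
apply/setP => s; rewrite simplicesE in_set1; apply/chainsP/eqP.
  by case=> _ /cards0_eq.
move=> ->; rewrite sub0set cards0; split=> //.
by apply/comparable_setP => x y; rewrite inE.
Qed.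

(** Hopf trace formula. The trace [c k] on cochains is [h k + b k + b k.+1], so the coboundary terms
    telescope; the first is zero by definition, and the last because no chain has more elements than
    there are flats. *)
Lemma mxtrace_cohomology_euler X g : g \in flat_stab presA X ->
  fixed_euler X g =
  \sum_(k < #|[set: flat A]|.+1) (-1) ^+ k * \tr (reduced_cohomology presA X k g).
Proof.
move=> gS; pose c k : R := \tr (simplex_repr presA X k g).
pose h k : R := \tr (reduced_cohomology presA X k g).
pose b k : R := \tr (submod_repr (coboundaries_module presA X k) g).
have chb k : c k = h k + b k + b k.+1.
  have homf := @coboundary_comm _ _ _ _ _ _ presA X k.
  have [modK [modI simI]] := rsim_coker_image homf.
  rewrite /c -(mxtrace_sub_fact_mod modK) (mxtrace_rsim simI) //.
  have E := mxtrace_submod_eq modI (coboundaries_module presA X k.+1) (eqmx_refl _) gS.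
  rewrite {}E -/(b k.+1); congr (_ + _).
  rewrite (mxtrace_submod_eq _ (cocycles_module presA X k)) //.
  rewrite (mxtrace_section (coboundaries_module presA X k) (cocycles_module presA X k)) //.
    by rewrite addrC.
  exact: coboundaries_sub_cocycles.
have tele n : \sum_(k < n) (-1) ^+ k * c k =
    \sum_(k < n) (-1) ^+ k * h k + b 0%N - (-1) ^+ n * b n.
  elim: n => [|n IHn]; first by rewrite !big_ord0 expr0 mul1r add0r subrr.
  rewrite !big_ord_recr IHn chb exprS /=.
  set S := \sum_(_ < _) _; move: ((-1) ^+ n) S => e S.
  ring.
have b0 : b 0%N = 0.
  by apply: mxtrace_dim0; rewrite mxrank0.
have bN : b #|[set: flat A]|.+1 = 0.
  apply: mxtrace_dim0; apply/eqP; rewrite -leqn0.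
  by apply: leq_trans (rank_leq_row _) _; rewrite simplices_big // cards0.
have := tele #|[set: flat A]|.+1; rewrite b0 bN mulr0 subr0 addr0 => <-.
by apply: eq_bigr => k _; rewrite /c mxtrace_perm_repr.
Qed.

Lemma mxtrace_total_cohomology X g : g \in flat_stab presA X ->
  \tr (total_cohomology presA X g) = (-1) ^+ (d - \rank X) * fixed_moebius X g.
Proof.
move=> gS; rewrite /total_cohomology mxtrace_dadd.
(* The only chain size at which cohomology can survive: one less than the codimension by Folkman's
   theorem, and the empty chain when X = V. *)
pose k0 := if row_full X then 0%N else (d - \rank X).-1.
have h0 k : k != k0 -> \tr (reduced_cohomology presA X k g) = 0.
  move=> kk0; apply: mxtrace_dim0 => /=; apply/eqP.
  rewrite mxrank_gen mxrank_eq0 in_factmod_eq0.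
  move: kk0; rewrite /k0; case: ifP => fX kk0.
    have c0 : #|simplices X k| = 0%N by rewrite simplices_full ?cards0.
    move: (cocycles X k) (coboundaries X k); rewrite c0 => U V.
    by rewrite flatmx0 sub0mx.
  apply: cocycles_sub_coboundaries; first by rewrite fX.
  apply: contra kk0 => /eqP <-; by rewrite eqxx.
have -> : \sum_(k < #|[set: flat A]|.+1) \tr (reduced_cohomology presA X k g) =
   (-1) ^+ k0 * fixed_euler X g.
  rewrite (mxtrace_cohomology_euler gS) mulr_sumr; apply: eq_bigr => k _.
  have [->|/h0->] := eqVneq (k : nat) k0; last by rewrite !mulr0.
  by rewrite signrMK.
rewrite /fixed_moebius /k0; case: ifP => fX; last first.
  have : (0 < d - \rank X)%N.
    by rewrite subn_gt0 ltn_neqAle rank_leq_row andbT; move/negbT: fX.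
  by case: (d - \rank X)%N => // n _; rewrite exprS mulN1r mulrNN.
have -> : (d - \rank X)%N = 0%N by apply/eqP; rewrite subn_eq0 (eqP fX).
rewrite !expr0 !mul1r /fixed_euler big_ord_recl [X in _ + X]big1 /=; last first.
  by move=> i _; rewrite simplices_full // big_set0 mulr0.
by rewrite addr0 mul1r simplices0 big_set1 /setact imset0 eqxx.
Qed.

End Cohomology.

(** * Determinants and fixed spaces *)

(** Compare two block triangular factorizations of one matrix. *)
Lemma det_1_sub_mulmx (F : fieldType) m n (B : 'M[F]_(m, n)) (C : 'M[F]_(n, m)) :
  \det (1%:M - B *m C) = \det (1%:M - C *m B).
Proof.
have e1 : block_mx 1%:M B C 1%:M
    = block_mx 1%:M 0 C 1%:M *m block_mx 1%:M B 0 (1%:M - C *m B).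
  by rewrite mulmx_block !(mul1mx, mul0mx, mulmx1, mulmx0, addr0, add0r) addrC subrK.
have e2 : block_mx 1%:M B C 1%:M
    = block_mx 1%:M B 0 1%:M *m block_mx (1%:M - B *m C) 0 C 1%:M.
  by rewrite mulmx_block !(mul1mx, mul0mx, mulmx1, mulmx0, addr0, add0r) subrK.
have := congr1 determinant e1; rewrite {1}e2 !det_mulmx !det_ublock !det_lblock.
by rewrite !det1 !mul1r !mulr1.
Qed.

Lemma det_1_sub_idem (F : fieldType) n (E : 'M[F]_n) : E *m E = E ->
  \det (1%:M - E *+ 2) = (-1) ^+ \rank E.
Proof.
move=> /mul_row_col_base_idem rc.
have -> : E *+ 2 = (col_base E *+ 2) *m row_base E.
  by rewrite -[in LHS](mulmx_base E) -!scaler_nat scalemxAl.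
rewrite det_1_sub_mulmx -scaler_nat -scalemxAr rc scale_scalar_mx -raddfB /=.
by rewrite det_scalar; congr (_ ^+ _); ring.
Qed.

Section CycleAverage.

Variables (F : numFieldType) (gT : finGroupType) (G : {group gT}).
Variables (n : nat) (rG : mx_representation F G n) (g : gT).
Hypothesis gG : g \in G.
Local Notation B := (rG g).

Definition cycle_avg : 'M[F]_n := (#[g]%g)%:R^-1 *: \sum_(h in <[g]>%g) rG h.
Local Notation E := cycle_avg.

Lemma order_neq0 : (#[g]%g)%:R != 0 :> F.
Proof. by rewrite pnatr_eq0 -lt0n order_gt0. Qed.

Lemma cycle_sub : <[g]>%g \subset G. Proof. by rewrite cycle_subG. Qed.

Lemma cycle_avgM h : h \in <[g]>%g -> E *m rG h = E.
Proof.
move=> hg; rewrite /E -scalemxAl mulmx_suml; congr (_ *: _).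
rewrite [RHS](reindex_inj (mulIg h)) /=; apply: eq_big => k; first by rewrite groupMr.
by move=> kg; rewrite repr_mxM // (subsetP cycle_sub).
Qed.

Lemma cycle_avg_fix m (v : 'M_(m, n)) : (v <= rfix_mx rG <[g]>%g)%MS -> v *m E = v.
Proof.
move/rfix_mxP => vg; rewrite /E -scalemxAr mulmx_sumr (eq_bigr (fun=> v)) //.
by rewrite sumr_const -/(order g) -scaler_nat scalerA mulVf ?order_neq0 ?scale1r.
Qed.

Lemma fix_cycle m (v : 'M_(m, n)) : v *m B = v -> (v <= rfix_mx rG <[g]>%g)%MS.
Proof.
move=> vB; apply/rfix_mxP => h hg.
have : <[g]>%g \subset rstab rG v by rewrite cycle_subG inE gG vB eqxx.
by move/subsetP/(_ h hg); rewrite inE => /andP[_ /eqP].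
Qed.

Lemma cycle_avg_sub : (E <= rfix_mx rG <[g]>%g)%MS.
Proof. by apply: fix_cycle; apply: cycle_avgM; apply: cycle_id. Qed.

Lemma cycle_avg_idem : E *m E = E.
Proof. exact: cycle_avg_fix cycle_avg_sub. Qed.

Lemma cycle_avg_comm : B *m E = E.
Proof.
rewrite /E -scalemxAr mulmx_sumr; congr (_ *: _).
rewrite [RHS](reindex_inj (mulgI g)) /=; apply: eq_big => k.
  by rewrite groupMl ?cycle_id.
by move=> kg; rewrite repr_mxM // (subsetP cycle_sub).
Qed.

Lemma rank_cycle_avg : \rank E = \rank (rfix_mx rG <[g]>%g).
Proof.
apply/eqmx_rank/andP; rewrite cycle_avg_sub; split=> //.
by rewrite -{1}(cycle_avg_fix (submx_refl (rfix_mx rG <[g]>%g))) submxMl.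
Qed.

Lemma det_repr_norm1 : `|\det B| = 1.
Proof.
have detX k : \det (rG (g ^+ k)%g) = \det B ^+ k.
  elim: k => [|k IHk]; first by rewrite expg0 repr_mx1 det1.
  by rewrite expgS repr_mxM ?groupX // det_mulmx IHk exprS.
have := detX (#[g]%g); rewrite expg_order repr_mx1 det1 => /(congr1 Num.norm).
rewrite normrX normr1 => /esym/eqP; rewrite pexpr_eq1 ?order_gt0 //.
by move/eqP.
Qed.

End CycleAverage.

Section DetSign.

Variables (F : rcfType) (gT : finGroupType) (G : {group gT}).
Variables (n : nat) (rG : mx_representation F G n) (g : gT).
Hypothesis gG : g \in G.
Local Notation B := (rG g).
Local Notation E := (cycle_avg rG g).

(** The quantity is the characteristic polynomial at 0. That polynomial is monic, hence positive far
    out, so a value <= 0 at 0 would produce a root >= 0. *)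
Lemma char_poly0_gt0 m (D : 'M[F]_m) :
  (forall a, 0 <= a -> ~~ eigenvalue D a) -> 0 < (-1) ^+ m * \det D.
Proof.
move=> noev; rewrite -char_poly_det -horner_coef0 ltNge; apply/negP => le0.
have lp : 0 < lead_coef (char_poly D) by rewrite (monicP (char_poly_monic D)).
have [M HM] := poly_pinfty_gt_lc lp.
have pM : 0 <= (char_poly D).[Num.max 0 M].
  by apply/ltW/(lt_le_trans lp)/HM; rewrite le_max lexx orbT.
have M0 : 0 <= Num.max 0 M by rewrite le_max lexx.
have [|x /andP[x0 _] rx] := @Num.Theory.poly_ivt F (char_poly D) _ _ M0.
  by rewrite le0.
by have := noev x x0; rewrite eigenvalue_root_char rx.
Qed.

(* With E the projection onto the fixed space of g, the operator rG g (1 - 2E) has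
   no eigenvalue >= 0, so its characteristic polynomial is positive at 0. *)
Lemma det_repr_sign : (-1) ^+ n * \det B = (-1) ^+ \rank (rfix_mx rG <[g]>%g).
Proof.
pose D := B *m (1%:M - E *+ 2).
have DE : D = B - E *+ 2.
  by rewrite /D mulmxBr mulmx1 -[E *+ 2]scaler_nat -scalemxAr (cycle_avg_comm _ gG).
have detD : \det D = \det B * (-1) ^+ \rank (rfix_mx rG <[g]>%g).
  by rewrite det_mulmx det_1_sub_idem ?(rank_cycle_avg _ gG) // (cycle_avg_idem _ gG).
suff pos : 0 < (-1) ^+ n * \det D.
  have : (-1) ^+ n * \det D = 1.
    rewrite -[LHS]gtr0_norm // !normrM detD normrM !normrX normrN1 !expr1n.
    by rewrite (det_repr_norm1 _ gG) !mulr1.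
  rewrite detD mulrA => /(congr1 ( *%R^~ ((-1) ^+ \rank (rfix_mx rG <[g]>%g)))).
  by rewrite -mulrA -expr2 sqrr_sign mulr1 mul1r.
apply: char_poly0_gt0 => a a0; apply/negP => /eigenvalueP[v vD nzv].
(* Since D E = -E, one gets a (v E) = -(v E), impossible for a >= 0 unless v E = 0. Then v is an
   eigenvector of g itself, finite order gives a = 1, and v = v E = 0. *)
have vE : v *m E = 0.
  have : v *m D *m E = - (v *m E).
    rewrite -mulmxA DE mulmxBl (cycle_avg_comm _ gG) -[E *+ 2]scaler_nat -scalemxAl.
    rewrite (cycle_avg_idem _ gG).
    by rewrite scaler_nat mulr2n opprD addrA subrr sub0r mulmxN.
  rewrite vD -scalemxAl => /eqP; rewrite -addr_eq0 -{2}[v *m E]scale1r -scalerDl.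
  by rewrite scaler_eq0 paddr_eq0 ?ler01 // oner_eq0 andbF => /eqP.
have vB : v *m B = a *: v.
  by rewrite -vD DE mulmxBr -[E *+ 2]scaler_nat -scalemxAr vE scaler0 subr0.
have vX k : v *m rG (g ^+ k)%g = a ^+ k *: v.
  elim: k => [|k IHk]; first by rewrite expg0 repr_mx1 mulmx1 expr0 scale1r.
  rewrite expgSr repr_mxM ?groupX // mulmxA IHk -scalemxAl vB scalerA.
  by rewrite exprSr.
have a1 : a = 1.
  have := vX (#[g]%g); rewrite expg_order repr_mx1 mulmx1 => /eqP.
  rewrite -subr_eq0 -{1}[v]scale1r -scalerBl scaler_eq0 (negPf nzv) orbF subr_eq0 eq_sym.
  by rewrite pexpr_eq1 ?order_gt0 // => /eqP.
move: vB; rewrite a1 scale1r => /(fix_cycle gG)/cycle_avg_fix.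
by rewrite vE => v0; rewrite v0 eqxx in nzv.
Qed.

End DetSign.

Section FixDim.
Variables (F : numFieldType) (gT : finGroupType) (G : {group gT}).
Variables (n : nat) (rG : mx_representation F G n) (U : 'M[F]_n).

(** Fixed dimensions are averages of traces, and traces add up over U and the quotient. *)
Lemma rank_rfix_sub_fact (modU : mxmodule rG U) (H : {group gT}) : H \subset G ->
  \rank (rfix_mx rG H) =
  (\rank (U :&: rfix_mx rG H)%MS + \rank (rfix_mx (factmod_repr modU) H))%N.
Proof.
move=> sHG; have E := rfix_submod modU sHG.
rewrite -(mxrank_in_submod (capmxSl U _)) -E.
apply/eqP; rewrite -(eqr_nat F) natrD -(inj_eq (mulfI (natr_cardG_neq0 F H))) mulrDr.
rewrite -!(sum_mxtrace_rfix (subg_repr _ sHG)) -big_split /=; apply/eqP.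
apply: eq_bigr => g _; exact: esym (mxtrace_sub_fact_mod modU g).
Qed.

End FixDim.

(** * Faces and supports *)

Section Faces.

Variables (R : realFieldType) (d : nat) (A : arrangement R d).
Implicit Types (i : hyp_index A) (x y z f : face A) (X Y Z : flat A).
Implicit Types (u v : 'rV[R]_d) (B : {set hyp_index A}).

Lemma face_ofE v i : face_of A v i = side i v.
Proof. by rewrite ffunE. Qed.

Lemma face_prodE x y i : face_prod x y i = side_comp (x i) (y i).
Proof. by rewrite ffunE. Qed.

Lemma face_ptE x i : side i (face_pt x) = x i.
Proof. by rewrite -face_ofE face_ptK. Qed.

Lemma face_eqP x y : (forall i, x i = y i) -> x = y.
Proof. by move=> e; apply: val_inj; apply/ffunP. Qed.

Lemma face_prodA x y z : face_prod x (face_prod y z) = face_prod (face_prod x y) z.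
Proof. by apply: face_eqP => i; rewrite !face_prodE; case: (x i). Qed.

Lemma face_prod_idem x y : face_prod (face_prod x y) x = face_prod x y.
Proof. by apply: face_eqP => i; rewrite !face_prodE; case: (x i); case: (y i). Qed.

Definition face0 : face A := face_of A 0.

Lemma face0E i : face0 i = None.
Proof. by rewrite face_ofE; apply: side_zero; rewrite mul0mx mxE. Qed.

Lemma face_prod0x x : face_prod face0 x = x.
Proof. by apply: face_eqP => i; rewrite face_prodE face0E. Qed.

Lemma hyperplane_proper i : ~~ (1%:M <= hyperplane i)%MS.
Proof.
apply/negP => /sub_kermxP; rewrite mul1mx => n0.
by have := normal_neq0 i; rewrite n0 eqxx.
Qed.

Lemma chambersP x : reflect (forall i, x i != None) (x \in chambers A).
Proof.
rewrite inE; apply: (iffP (asboolP _)) => [[B fB eB] i|nx].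
  apply/eqP => xi; have : (B <= hyperplane i)%MS.
    by apply/row_subP => k; rewrite -side_None -face_ofE eB xi.
  by move/(submx_trans _) => h; case/negP: (hyperplane_proper i); apply: h; rewrite sub1mx.
(* The points v + e_k (sg_k delta_k) are independent because v_k / (e_k sg_k) >= 0. *)
set v := face_pt x; pose sg k : R := if 0 <= v 0 k then 1 else -1.
have : forall k, exists e : R, 0 < e /\ face_of A (v + e *: (sg k *: delta_mx 0 k)) = x.
  move=> k; have [e e0 he] := small_eps A v (sg k *: delta_mx 0 k).
  exists e; split=> //; apply: face_eqP => i; rewrite face_ofE he face_ptE.
  by have := nx i; case: (x i).
move=> /choice[e /all_and2[e0 he]].
exists (\matrix_k (v + e k *: (sg k *: delta_mx 0 k))); last by move=> k; rewrite rowK.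
rewrite row_full_unit -row_free_unit -kermx_eq0; apply/rowV0P => u /sub_kermxP uB.
pose s := \sum_k u 0 k; pose c k := v 0 k / (e k * sg k).
have esg k : e k * sg k != 0.
  apply: mulf_neq0; first by rewrite gt_eqF.
  by rewrite /sg; case: ifP => _; rewrite ?oppr_eq0 oner_eq0.
have uE k : u 0 k = - (s * c k).
  have := congr1 (fun M : 'rV_d => M 0 k) uB; rewrite !mxE.
  rewrite (eq_bigr (fun l => u 0 l * v 0 k + u 0 l * (e l * sg l) * (l == k)%:R)); last first.
    by move=> l _; rewrite !mxE /= mulrDr -!mulrA (eq_sym k).
  rewrite big_split /= -mulr_suml -/s (bigD1 k) //= eqxx mulr1 big1 ?addr0; last first.
    by move=> l /negPf->; rewrite mulr0.
  move=> h; apply: (mulIf (esg k)); rewrite mulNr /c -mulrA divfK //.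
  by apply/eqP; rewrite -addr_eq0 addrC h.
have c0 k : 0 <= c k.
  rewrite /c /sg; case: ifPn => [h|]; first by rewrite mulr1 divr_ge0 // ltW.
  rewrite -ltNge => h; rewrite mulrN1 invrN mulrN -mulNr divr_ge0 // ?ltW //.
  by rewrite oppr_gt0.
(* Summing [uE] over k gives s = -s (sum of the c_k); as c_k >= 0 this forces s = 0 and then u =
   0. *)
have s0 : s * (1 + \sum_k c k) = 0.
  rewrite mulrDr mulr1 mulr_sumr {1}/s (eq_bigr _ (fun k _ => uE k)) sumrN.
  by rewrite addNr.
have {}s0 : s = 0.
  move/eqP: s0; rewrite mulf_eq0 => /orP[/eqP //|].
  by rewrite gt_eqF // ltr_wpDr // sumr_ge0.
by apply/rowP => k; rewrite uE s0 mul0r oppr0 mxE.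
Qed.

Definition supp x : flat A := flat_of [set i | x i == None].

Lemma face_sub_flat_of x B : face_sub x (flat_of B) <-> (forall i, i \in B -> x i = None).
Proof.
split=> [/asboolP h i iB|h].
  have := h _ (face_ptK x) => /flat_ofP/(_ i iB).
  by rewrite -side_None face_ptE => /eqP.
apply/asboolP => v vx; apply/flat_ofP => i iB.
by rewrite -side_None -face_ofE vx h.
Qed.

Lemma face_sub_supp x X : face_sub x X = (supp x <= X)%MS.
Proof.
have [B ->] := flat_surj X; apply/idP/idP.
  move/face_sub_flat_of => h; apply/flat_ofP => i iB.
  by apply: (flat_ofP _ _ (submx_refl (supp x))); rewrite inE h.
move=> h; apply/asboolP => v vx; apply: submx_trans h.
by apply/flat_ofP => i; rewrite inE => /eqP xi; rewrite -side_None -face_ofE vx xi.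
Qed.

Lemma face_sub_refl x : face_sub x (supp x).
Proof. by rewrite face_sub_supp. Qed.

Lemma supp_hyperplane x i : (supp x <= hyperplane i)%MS = (x i == None).
Proof.
apply/idP/eqP => [h|xi].
  have := face_sub_refl x => /asboolP/(_ _ (face_ptK x))/submx_trans/(_ h).
  by rewrite -side_None face_ptE => /eqP.
by apply: (flat_ofP _ _ (submx_refl (supp x))); rewrite inE xi.
Qed.

Lemma supp_le x y : (forall i, y i = None -> x i = None) -> (supp x <= supp y)%MS.
Proof.
move=> h; apply/flat_ofP => i; rewrite inE => /eqP yi.
by rewrite supp_hyperplane h.
Qed.

Lemma face_sub_prod x y X : face_sub (face_prod x y) X = face_sub x X && face_sub y X.
Proof.
have [B ->] := flat_surj X; apply/idP/andP.
  move/face_sub_flat_of => h; split; apply/face_sub_flat_of => i /h;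
  by rewrite face_prodE; case: (x i).
move=> [/face_sub_flat_of hx /face_sub_flat_of hy]; apply/face_sub_flat_of => i iB.
by rewrite face_prodE hx //= hy.
Qed.

Lemma face_sub0 X : face_sub face0 X.
Proof. by have [B ->] := flat_surj X; apply/face_sub_flat_of => i _; apply: face0E. Qed.

Lemma supp_full x : row_full (supp x) = (x \in chambers A).
Proof.
apply/idP/chambersP => [f i|h].
  rewrite -supp_hyperplane; apply/negP => h; case/negP: (hyperplane_proper i).
  by apply: submx_trans h; rewrite sub1mx.
rewrite -sub1mx; apply/flat_ofP => i; rewrite inE => /eqP xi; by have := h i; rewrite xi.
Qed.

Section Action.

Variables (gT : finGroupType) (W : {group gT}) (rW : mx_representation R W d).
Variable presA : preserves A rW.
Local Notation fact := (face_act presA).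
Local Notation lact := (flat_act presA).

Lemma face_sub_actW g x X : g \in W -> face_sub x X -> face_sub (fact x g) (lact X g).
Proof.
move=> gW /asboolP h; apply/asboolP => v vx; rewrite flat_actE //.
have gVW : g^-1%g \in W by rewrite groupV.
have vE : v = v *m rW g^-1%g *m rW g.
  by rewrite -mulmxA -repr_mxM // mulVg repr_mx1 mulmx1.
rewrite vE; apply/submxMr/h.
by rewrite -(face_act_of presA) // vx; apply: (actKin fact gW).
Qed.

Lemma face_sub_act g x X : g \in W -> face_sub (fact x g) (lact X g) = face_sub x X.
Proof.
move=> gW; apply/idP/idP; last exact: face_sub_actW.
have gVW : g^-1%g \in W by rewrite groupV.
by move/(face_sub_actW gVW); rewrite (actKin fact gW) (actKin lact gW).
Qed.

Lemma supp_act g x : g \in W -> supp (fact x g) = lact (supp x) g.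
Proof.
move=> gW; have gVW : g^-1%g \in W by rewrite groupV.
apply: flat_eqmx_inj; apply/eqmxP/andP; split.
  by rewrite -face_sub_supp face_sub_act // face_sub_refl.
have -> : supp (fact x g) = lact (lact (supp (fact x g)) g^-1%g) g.
  by rewrite (actKVin lact gW).
rewrite -/(flat_le _ _) flat_act_le // /flat_le -face_sub_supp.
by rewrite -(face_sub_act _ _ gW) (actKVin lact gW) face_sub_refl.
Qed.

Lemma rank_flat_act g X : g \in W -> \rank (lact X g) = \rank X.
Proof.
by move=> gW; rewrite flat_actE // mxrankMfree // row_free_unit repr_mx_unit.
Qed.

Section Twist.

Variables (x : face A) (g : gT).
Hypothesis gW : g \in W.

Definition twist z : face A := fact (face_prod x z) g.
Local Notation phi := twist.

Lemma twistM z w : phi (face_prod z w) = face_prod (phi z) (fact w g).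
Proof. by rewrite /phi face_prodA face_prod_act. Qed.

Lemma iter_twistM k z w :
  iter k phi (face_prod z w) = face_prod (iter k phi z) (fact w (g ^+ k)%g).
Proof.
elim: k => [|k IHk]; first by rewrite expg0 act1.
by rewrite !iterS IHk twistM expgSr actMin ?groupX.
Qed.

(* The fixed points of [twist] are the products [twist_limit * face_of u] with u
   fixed by g, so they are counted by the Euler relation on the fixed space. *)
Definition twist_limit : face A := iter #[g]%g phi face0.
Local Notation f := twist_limit.

Lemma iter_twist_order w : iter #[g]%g phi w = face_prod f w.
Proof. by rewrite -{1}[w]face_prod0x iter_twistM expg_order act1. Qed.

(** [phi f] equals f (x g), and f itself starts with the factor x g, so the identity x y x = x y
    absorbs the extra factor. *)
Lemma twist_core_fixed : phi f = f.
Proof.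
rewrite -[LHS]/(iter #[g]%g.+1 phi face0) iterSr iter_twist_order.
have -> : phi face0 = fact x g.
  by congr (fact _ g); apply: face_eqP => i; rewrite face_prodE face0E; case: (x i).
rewrite /f -(prednK (order_gt0 g)) iterS; set w := iter _ _ _.
rewrite [phi w](_ : _ = face_prod (fact x g) (fact w g)) ?face_prod_idem //.
by rewrite face_prod_act.
Qed.

Lemma face_sub_twist z X : lact X g = X -> face_sub x X -> face_sub z X ->
  face_sub (phi z) X.
Proof.
by move=> Xg xX zX; rewrite -Xg face_sub_act // face_sub_prod xX.
Qed.

Lemma face_sub_core X : lact X g = X -> face_sub x X -> face_sub f X.
Proof.
move=> Xg xX; rewrite /f; elim: #[g]%g => [|k IHk] /=; first exact: face_sub0.
exact: face_sub_twist.
Qed.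

(** The support of x z contains that of z, and g carries it onto that of z; equal dimensions make
    them coincide. *)
Lemma twist_fixed_supp z : phi z = z -> lact (supp z) g = supp z /\ face_sub x (supp z).
Proof.
move=> e.
have E : lact (supp (face_prod x z)) g = supp z by rewrite -supp_act // -/(phi z) e.
have le : (supp z <= supp (face_prod x z))%MS.
  by apply: supp_le => i; rewrite face_prodE; case: (x i).
have rk : \rank (supp (face_prod x z)) = \rank (supp z).
  by rewrite -(rank_flat_act _ gW) E.
have S : supp (face_prod x z) = supp z.
  apply/esym/flat_eqmx_inj/eqmxP; rewrite -(mxrank_leqif_eq le) rk //.
split; first by rewrite -{1}S.
by have := face_sub_refl (face_prod x z); rewrite S face_sub_prod => /andP[].
Qed.

Local Notation Fix := (rfix_mx rW <[g]>%g).

Lemma fix_mul u : (u <= Fix)%MS -> u *m rW g = u.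
Proof. by move/rfix_mxP => h; apply: h; apply: cycle_id. Qed.

Lemma side_sum_cycle i v t n : (forall k, side i (v *m rW (g ^+ k)%g) = t) ->
  side i (\sum_(k < n.+1) v *m rW (g ^+ k)%g) = t.
Proof.
move=> h; elim: n => [|n IHn]; first by rewrite big_ord1.
rewrite big_ord_recr /= -[X in X + _]scale1r -[X in _ + X]scale1r.
by rewrite side_cone ?ltr01 // IHn.
Qed.

Lemma twist_fixed_img X : lact X g = X -> face_sub x X ->
  sides_img (X :&: Fix)%MS f [set i | f i == None] =
  [set face_sides z | z in [set z | (phi z == z) && face_sub z X]].
Proof.
move=> Xg xX; set J := [set i | _]; have fX := face_sub_core Xg xX.
have onJ u : sides_on f J u = face_prod f (face_of A u).
  apply/ffunP => i; rewrite ffunE inE face_prodE face_ofE.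
  by case: (f i).
have phi_core k w : iter k phi (face_prod f w) = face_prod f (fact w (g ^+ k)%g).
  rewrite iter_twistM; congr (face_prod _ _).
  by elim: k => //= k ->; apply: twist_core_fixed.
apply/setP => s; apply/sides_img_onP/imsetP => [[u uU <-]|[z]].
  move: uU; rewrite sub_capmx => /andP[uX uF].
  exists (face_prod f (face_of A u)); last exact: onJ.
  rewrite inE face_sub_prod fX /= twistM twist_core_fixed /= face_act_of // fix_mul //.
  rewrite eqxx /=; apply/asboolP => v /face_ofP e.
  have [B XB] := flat_surj X; move: uX; rewrite XB => /flat_ofP uX.
  by apply/flat_ofP => i /uX; rewrite -!side_None e.
rewrite inE => /andP[/eqP phz zX] ->.
have iz k : iter k phi z = z by elim: k => //= k ->.
have fz : face_prod f z = z by rewrite -iter_twist_order iz.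
pose v := face_pt z; have vX : (v <= X)%MS by move/asboolP: zX; apply; apply: face_ptK.
(* The orbit sum of a point of z is fixed by g. On a hyperplane containing f all its terms lie on
   the side of z, because z = f (z g^k). The bound [.-1.+1] fits [side_sum_cycle]. *)
pose u := \sum_(k < #[g]%g.-1.+1) v *m rW (g ^+ k)%g.
have vkX k : (v *m rW (g ^+ k)%g <= X)%MS.
  elim: k => [|k IHk]; first by rewrite expg0 repr_mx1 mulmx1.
  by rewrite expgSr repr_mxM ?groupX // mulmxA -Xg flat_actE // submxMr.
exists u.
  rewrite sub_capmx summx_sub => [/=|k _]; last exact: vkX.
  apply: (fix_cycle gW); rewrite /u mulmx_suml big_ord_recr big_ord_recl /= addrC.
  rewrite -mulmxA -repr_mxM ?groupX // -expgSr prednK ?order_gt0 // expg_order expg0.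
  congr (_ + _); apply: eq_bigr => k _.
  by rewrite -mulmxA -repr_mxM ?groupX // -expgSr.
rewrite onJ; apply/ffunP => i; rewrite face_prodE face_ofE -[in RHS]fz face_prodE.
case fi: (f i) => //=; apply: side_sum_cycle => k.
rewrite -face_ofE -(face_act_of presA) ?groupX // face_ptK.
have := phi_core k z; rewrite fz iz => {2}->; by rewrite face_prodE fi.
Qed.

Lemma twist_fixed_euler X : lact X g = X -> face_sub x X ->
  \sum_(z | (phi z == z) && face_sub z X) (-1) ^+ \rank (supp z :&: Fix)%MS
  = (-1) ^+ \rank (X :&: Fix)%MS :> R.
Proof.
move=> Xg xX; rewrite -(euler_relation _ f [set i | f i == None]).
rewrite (twist_fixed_img Xg xX) big_imset /=; last by move=> z1 z2 _ _ /val_inj.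
rewrite [RHS](eq_bigl (fun z => (phi z == z) && face_sub z X)); last first.
  by move=> z; rewrite inE.
apply: eq_bigr => z /andP[/eqP phz zX]; congr (_ ^+ _).
have iz k : iter k phi z = z by elim: k => //= k ->.
have fz : face_prod f z = z by rewrite -iter_twist_order iz.
apply/eqmx_rank/andP; split.
  apply/sides_span_sub; split; first by rewrite capmxS // -face_sub_supp.
  by move=> i _ zi; apply: submx_trans (capmxSl _ _) _; rewrite supp_hyperplane zi.
have /sides_span_sub[hU hi] :=
  submx_refl (sides_span (X :&: Fix)%MS [set i | f i == None] z).
rewrite sub_capmx (submx_trans hU (capmxSr _ _)) andbT.
apply/flat_ofP => i; rewrite inE => /eqP zi; apply: hi => //.
by rewrite inE; move: zi; rewrite -fz face_prodE; case: (f i).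
Qed.

End Twist.
End Action.
End Faces.

(** * Moebius inversion over the fixed flats *)

#[local] Arguments act {aT D rT} to x a : simpl never.

Section Moebius.

Variables (R : realFieldType) (d : nat) (A : arrangement R d).
Variables (gT : finGroupType) (W : {group gT}) (rW : mx_representation R W d).
Variable presA : preserves A rW.
Implicit Types (X Y Z : flat A) (s : {set flat A}).
Local Notation lact := (flat_act presA).

Section Fixed.

Variable g : gT.
Hypothesis gW : g \in W.

Definition pointwise_fixed s := [forall Y in s, lact Y g == Y].

Definition flat_chains X : {set {set flat A}} :=
  [set s : {set flat A} | (s \subset interval X) && comparable_set (@flat_lt R d A) s].

(** g preserves ranks, and a chain has at most one flat of each rank. *)
Lemma setact_chain s : comparable_set (@flat_lt R d A) s ->
  ((lact^*)%act s g == s) = pointwise_fixed s.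
Proof.
move=> cs; apply/eqP/forall_inP => [e Y Ys|h].
  have Ygs : lact Y g \in s by rewrite -e; apply: imset_f.
  have rk : \rank (lact Y g : flat A) = \rank (Y : flat A).
    by rewrite flat_actE // mxrankMfree // row_free_unit repr_mx_unit.
  move/comparable_setP: cs => /(_ _ _ Ygs Ys) /or3P[//|/flat_lt_rank|/flat_lt_rank];
    by rewrite rk ltnn.
have e1 : {in s, forall Y, lact Y g = Y} by move=> Y /h/eqP.
by transitivity [set lact Y g | Y in s]; rewrite // (eq_in_imset e1) imset_id.
Qed.

Lemma mem_simplices X k s :
  (s \in simplices X k) = (s \in flat_chains X) && (#|s| == k).
Proof.
rewrite simplicesE; apply/chainsP/andP => [[h1 <- h2]|[]]; rewrite inE.
  by rewrite h1 h2 eqxx.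
by case/andP => h1 h2 /eqP ->.
Qed.

Lemma fixed_eulerE X :
  fixed_euler presA X g = \sum_(s in flat_chains X | pointwise_fixed s) (-1) ^+ #|s|.
Proof.
pose card_ord s : 'I_#|[set: flat A]|.+1 := inord #|s|.
rewrite (partition_big card_ord predT) //=.
apply: eq_bigr => k _; rewrite mulr_sumr.
have cardk (s : {set flat A}) : (inord #|s| == k) = (#|s| == k :> nat).
  by rewrite -val_eqE /= inordK // ltnS subset_leq_card //.
rewrite big_mkcond [RHS]big_mkcond; apply: eq_bigr => s _.
rewrite mem_simplices cardk; case sX: (s \in _) => //=.
case: eqP => [<-|]; last by rewrite andbF.
rewrite setact_chain; last by move: sX; rewrite inE => /andP[].
by case: pointwise_fixed; rewrite ?mulr1 ?mulr0.
Qed.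

Definition is_top s Z := (Z \in s) && [forall Y in s, flat_le Y Z].

Lemma is_topP s : s != set0 -> comparable_set (@flat_lt R d A) s -> exists Z, is_top s Z.
Proof.
move=> /set0Pn[Z0 Z0s] /comparable_setP cs.
have [Z Zs Zmin] := @arg_minnP _ Z0 (mem s) (fun Z => \rank Z) Z0s.
rewrite /= in Zs; exists Z; rewrite /is_top Zs; apply/forall_inP => Y Ys.
case/or3P: (cs _ _ Ys Zs) => [/eqP->|/ltmxW //|/flat_lt_rank].
  by rewrite /flat_le.
by rewrite ltnNge Zmin.
Qed.

Lemma is_top_uniq s Y Z : is_top s Y -> is_top s Z -> Y = Z.
Proof.
move=> /andP[Ys /forall_inP hY] /andP[Zs /forall_inP hZ].
by apply: flat_eqmx_inj; apply/eqmxP/andP; split; [apply: hY | apply: hZ].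
Qed.

Lemma flat_chain_setU1 Z X s : Z \in interval X -> s \in flat_chains Z ->
  [/\ Z |: s \in flat_chains X, Z \notin s & is_top (Z |: s) Z].
Proof.
move=> ZX; rewrite !inE => /andP[/subsetP sZ /comparable_setP cs].
have Zs : Z \notin s.
  by apply/negP => /sZ; rewrite inE ltmx_irrefl.
have [XZ Z1] := interval_ltmx ZX.
split=> //; last first.
  rewrite /is_top setU11; apply/forall_inP => Y; rewrite !inE.
  case/predU1P => [->|/sZ]; first by rewrite /flat_le.
  by rewrite inE => /andP[/ltmxW].
apply/andP; split.
  apply/subsetP => Y; rewrite !inE => /predU1P[->|/sZ]; first by rewrite XZ.
  by rewrite inE => /andP[ZY ->]; rewrite (ltmx_trans XZ ZY).
apply/comparable_setP => Y Y'; rewrite !inE => /predU1P[->|Ys] /predU1P[->|Ys'].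
- by rewrite eqxx.
- by move/sZ: Ys'; rewrite inE /flat_lt => /andP[-> _]; rewrite !orbT.
- by move/sZ: Ys; rewrite inE /flat_lt => /andP[-> _]; rewrite !orbT.
exact: cs.
Qed.

Lemma flat_chain_setD1 Z X s : s \in flat_chains X -> is_top s Z ->
  Z \in interval X /\ s :\ Z \in flat_chains Z.
Proof.
rewrite !inE => /andP[/subsetP sX cs] /andP[Zs /forall_inP hZ]; split.
  by move/sX: Zs; rewrite inE.
rewrite (comparable_setS (subD1set _ _) cs) andbT; apply/subsetP => Y.
rewrite in_setD1 => /andP[YZ Ys]; have := sX _ Ys; rewrite !inE => /andP[_ ->].
rewrite andbT ltmxE; have := hZ Y Ys; rewrite /flat_le => -> /=.
apply: contra YZ => YZ; apply/eqP/flat_eqmx_inj/eqmxP; rewrite YZ; exact: hZ.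
Qed.

(** Sort the nonempty fixed chains by their top element Z, the smallest subspace; removing Z leaves
    a fixed chain of (V, Z) and flips the sign. *)
Lemma fixed_euler_rec X :
  fixed_euler presA X g =
  1 - \sum_(Z in interval X | lact Z g == Z) fixed_euler presA Z g.
Proof.
rewrite fixed_eulerE (bigD1 set0) /=; last first.
  rewrite inE sub0set /=; apply/andP; split.
    by apply/comparable_setP => Y Z; rewrite inE.
  by apply/forall_inP => Y; rewrite inE.
rewrite cards0 expr0; congr (_ + _); rewrite -sumrN.
pose top s := odflt X [pick Z | is_top s Z].
have topE s : s != set0 -> comparable_set (@flat_lt R d A) s -> is_top s (top s).
  move=> s0 cs; rewrite /top; case: pickP => //= h.
  by have [Z] := is_topP s0 cs; rewrite h.
have topU s Z : is_top s Z -> top s = Z.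
  by rewrite /top; case: pickP => [Y|->//] /= /is_top_uniq; apply.
rewrite (partition_big top (fun Z => (Z \in interval X) && (lact Z g == Z))) /=; last first.
  move=> s /andP[/andP[sX fs] s0].
  have cs : comparable_set (@flat_lt R d A) s by move: sX; rewrite inE => /andP[].
  have tops := topE s s0 cs.
  have [-> _] := flat_chain_setD1 sX tops; move/forall_inP: fs; apply.
  by case/andP: tops.
apply: eq_bigr => Z /andP[ZX Zg]; rewrite fixed_eulerE -sumrN.
rewrite (reindex_onto (fun s => Z |: s) (fun s => s :\ Z)) /=; last first.
  move=> s /andP[/andP[/andP[sX fs] s0] /eqP topZ]; rewrite setD1K //.
  have cs : comparable_set (@flat_lt R d A) s by move: sX; rewrite inE => /andP[].
  by have := topE s s0 cs; rewrite topZ => /andP[].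
apply: eq_big => [s|s].
  apply/idP/andP.
    case/andP => /andP[/andP[/andP[sX fs] s0] /eqP topZ] /eqP sZ.
    have cs : comparable_set (@flat_lt R d A) (Z |: s) by move: sX; rewrite inE => /andP[].
    have := topE _ s0 cs; rewrite topZ => isT.
    have [_] := flat_chain_setD1 sX isT; rewrite sZ => ->; split=> //.
    apply/forall_inP => Y Ys; move/forall_inP: fs; apply; exact: setU1r.
  case=> sZ fs; have [h1 h2 h3] := flat_chain_setU1 ZX sZ.
  rewrite h1 (topU _ _ h3) eqxx setU1K // eqxx !andbT; apply/andP; split.
    apply/forall_inP => Y; rewrite in_setU1 => /predU1P[->//|].
    by move/forall_inP: fs; apply.
  by apply/set0Pn; exists Z; apply: setU11.
case/andP => _ /eqP sZ; rewrite cardsU1.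
have -> : Z \notin s by rewrite -sZ !inE eqxx.
by rewrite exprS mulN1r.
Qed.

(** The defining recursion of mu_g: once Z = X and Z = V are split off, the remaining sum is the one
    in [fixed_euler_rec]. *)
Lemma fixed_moebius_sum X : lact X g = X ->
  \sum_(Z | (lact Z g == Z) && (X <= (Z : flat A))%MS) fixed_moebius presA Z g
  = (row_full X)%:R.
Proof.
move=> Xg; rewrite (bigD1 X) /=; last by rewrite Xg eqxx submx_refl.
have [fX|nfX] := boolP (row_full X).
  rewrite big1 => [|Z]; first by rewrite /fixed_moebius fX /= addr0.
  case/andP=> /andP[_ XZ] /negP[].
  apply/eqP/esym/flat_eqmx_inj/eqmxP; rewrite XZ /=; apply: submx_trans (submx1 _) _.
  by rewrite sub1mx.
pose V : flat A := flat_of set0.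
have fV : row_full V by rewrite -sub1mx; apply/flat_ofP => i; rewrite inE.
have Vu Z : row_full Z -> Z = V.
  rewrite -sub1mx => fZ; apply: flat_eqmx_inj; apply/eqmxP.
  by rewrite (submx_trans (submx1 _) fZ) (submx_trans (submx1 _)) // sub1mx.
have Vg : lact V g = V.
  apply: Vu; rewrite -sub1mx flat_actE // sub1mx row_full_unit unitmx_mul.
  by rewrite -row_full_unit fV repr_mx_unit.
rewrite [X in _ + X](bigD1 V) /=; last first.
  rewrite Vg eqxx (submx_trans (submx1 _)) ?sub1mx // andTb.
  by apply: contra nfX => /eqP <-.
rewrite {1 2}/fixed_moebius (negPf nfX) fV fixed_euler_rec opprB.
rewrite (eq_bigl (fun Z => (Z \in interval X) && (lact Z g == Z))).
  rewrite [X in _ + (_ + X)](eq_bigr (fun Z => - fixed_euler presA Z g)).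
    rewrite sumrN; ring.
  move=> Z /andP[/interval_ltmx[_]]; rewrite ltmx1 => nfZ _.
  by rewrite /fixed_moebius (negPf nfZ).
move=> Z; rewrite inE ltmxE ltmx1; case: eqP => //= Zg; last by rewrite andbF.
rewrite andbT; case XZ: (X <= Z)%MS => //=; congr (_ && _).
  apply/idP/idP => [ZX|].
    by apply: contra ZX => ZX; apply/eqP/flat_eqmx_inj/eqmxP; rewrite ZX.
  by apply: contra => /eqP ->.
apply/idP/idP => [ZV|]; first by apply: contra ZV => /Vu ->.
by apply: contra => /eqP ->.
Qed.

End Fixed.
End Moebius.

(** * The walk *)

Section Walk.

Variables (R : realFieldType) (d : nat) (A : arrangement R d).
Implicit Types (x y z f : face A) (X Y Z : flat A).

Definition face_mx x : 'M[R]_#|chambers A| :=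
  \matrix_(i, j) (face_prod x (enum_val i) == enum_val j)%:R.

Lemma face_prod_chamber x y : y \in chambers A -> face_prod x y \in chambers A.
Proof.
move/chambersP => h; apply/chambersP => i; rewrite face_prodE.
by case: (x i) => //=; apply: h.
Qed.

Lemma face_mx_mul x n (F : face A -> 'I_n -> R) i k :
  (face_mx x *m \matrix_(i < #|chambers A|, j < n) F (enum_val i) j) i k
  = F (face_prod x (enum_val i)) k.
Proof.
have cB : face_prod x (enum_val i) \in chambers A.
  by apply: face_prod_chamber; apply: enum_valP.
rewrite mxE (bigD1 (enum_rank_in cB (face_prod x (enum_val i)))) //= !mxE.
rewrite enum_rankK_in // eqxx mul1r big1 ?addr0 // => j nej.
rewrite !mxE; case: eqP => [e|_]; last by rewrite mul0r.
by case/eqP: nej; apply: enum_val_inj; rewrite enum_rankK_in.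
Qed.

(** The order is reversed because matrices act on rows from the right. *)
Lemma face_mxM x y : face_mx y *m face_mx x = face_mx (face_prod x y).
Proof.
apply/matrixP => i j; rewrite /face_mx.
rewrite (face_mx_mul y (fun c j => (face_prod x c == enum_val j)%:R)) mxE.
by rewrite face_prodA.
Qed.

Lemma face_mx0 : face_mx (face0 A) = 1%:M.
Proof.
by apply/matrixP => i j; rewrite !mxE face_prod0x (inj_eq enum_val_inj).
Qed.

Section Weights.

Variable p : face A -> R.
Local Notation T := (walk_mx p).
Local Notation wt := (flat_weight p).

Lemma walk_mxE : T = \sum_x p x *: face_mx x.
Proof.
apply/matrixP => i j; rewrite mxE summxE big_mkcond; apply: eq_bigr => x _.
by rewrite !mxE; case: eqP; rewrite ?mulr1 ?mulr0.
Qed.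

Definition walk_weights : seq R := undup [seq wt X | X : flat A].

Lemma mem_walk_weights X : wt X \in walk_weights.
Proof. by rewrite mem_undup; apply/imageP; exists X. Qed.

Lemma walk_weightsP a : a \in walk_weights -> exists X, a = wt X.
Proof. by rewrite mem_undup => /imageP[X _ ->]; exists X. Qed.

Lemma face_prod_sub f x : face_sub x (supp f) -> face_prod f x = f.
Proof.
move=> xf; apply: face_eqP => i; rewrite face_prodE; case fi: (f i) => //=.
move: xf; rewrite face_sub_supp => /submx_trans h; apply/eqP.
by rewrite -supp_hyperplane h // supp_hyperplane fi.
Qed.

Hypothesis p_ge0 : forall x, 0 <= p x.

Lemma flat_weight_lt f x : p x != 0 -> ~~ face_sub x (supp f) ->
  wt (supp f) < wt (supp (face_prod f x)).
Proof.
move=> px nxf; have le : (supp f <= supp (face_prod f x))%MS.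
  by apply: supp_le => i; rewrite face_prodE; case: (f i).
have xs : face_sub x (supp (face_prod f x)).
  by have := face_sub_refl (face_prod f x); rewrite face_sub_prod => /andP[].
rewrite /flat_weight.
rewrite (bigID (fun z => face_sub z (supp f)) (fun z => face_sub z (supp (face_prod f x)))) /=.
rewrite [X in _ < X + _](eq_bigl (fun z => face_sub z (supp f))); last first.
  move=> z; rewrite andbC; apply/andb_idr; rewrite !face_sub_supp => /submx_trans; exact.
rewrite ltrDl (bigD1 x) ?xs //=; apply: ltr_wpDr; first exact: sumr_ge0.
by rewrite lt_neqAle eq_sym px p_ge0.
Qed.

Lemma walk_mul_face_mx f :
  (T - (wt (supp f))%:M) *m face_mx f =
  \sum_(x | ~~ face_sub x (supp f)) p x *: face_mx (face_prod f x).
Proof.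
rewrite mulmxBl mul_scalar_mx walk_mxE mulmx_suml.
rewrite (bigID (fun x => face_sub x (supp f))) /= /flat_weight scaler_suml.
rewrite (eq_bigr (fun x => p x *: face_mx f)); last first.
  by move=> x xf; rewrite -scalemxAl face_mxM face_prod_sub.
rewrite addrAC subrr add0r; apply: eq_bigr => x _.
by rewrite -scalemxAl face_mxM.
Qed.

(* Right multiplication by the walk is triangular: f a = lambda_f f + (terms f x
   with strictly larger weight), since p >= 0; hence each eigenvalue is needed
   only once in an annihilating product. *)
Lemma prod_sub_scalar_face_mx f s :
    (forall h : face A, wt (supp f) <= wt (supp h) -> wt (supp h) \in s) ->
  prod_sub_scalar T s *m face_mx f = 0.
Proof.
have [n] := ubnP #|[set h : face A | wt (supp f) < wt (supp h)]|.
elim: n => // n IHn in f s *; rewrite ltnS => leN hs.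
have fs : wt (supp f) \in s by apply: hs.
rewrite (prod_sub_scalar_rem T fs) -mulmxA walk_mul_face_mx mulmx_sumr big1 // => x nx.
have [->|px] := eqVneq (p x) 0; first by rewrite scale0r mulmx0.
have lt := flat_weight_lt px nx.
rewrite -scalemxAr IHn ?scaler0 //.
  apply: leq_trans leN; apply: proper_card; apply/properP; split.
    by apply/subsetP => h; rewrite !inE; apply: lt_trans.
  by exists (face_prod f x); rewrite inE ?ltxx.
move=> h le; have flt := lt_le_trans lt le; have := hs h (ltW flt).
by rewrite (perm_mem (perm_to_rem fs)) inE gt_eqF.
Qed.

Lemma walk_annihilated : prod_sub_scalar T walk_weights = 0.
Proof.
have := @prod_sub_scalar_face_mx (face0 A) walk_weights.
by rewrite face_mx0 mulmx1; apply => h _; apply: mem_walk_weights.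
Qed.

End Weights.

(* b |-> sum_{x <= X} b_x is multiplicative on the face algebra, so it takes the
   value q(lambda_X) on q(T). *)
Lemma prod_sub_scalar_coef p s : exists b : face A -> R,
  prod_sub_scalar (walk_mx p) s = \sum_x b x *: face_mx x /\
  forall X, \sum_(x | face_sub x X) b x = \prod_(a <- s) (flat_weight p X - a).
Proof.
elim: s => [|l s [b [eb wb]]].
  exists (fun x => (x == face0 A)%:R); split=> [|X].
    rewrite (bigD1 (face0 A)) //= eqxx scale1r face_mx0 big1 ?addr0 // => x /negPf->.
    by rewrite scale0r.
  rewrite big_nil (bigD1 (face0 A)) ?face_sub0 //= eqxx big1 ?addr0 //.
  by move=> x /andP[_ /negPf->].
pose b' z := \sum_x \sum_(y | face_prod x y == z) p x * b y - l * b z.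
exists b'; split=> [|X].
  rewrite /= eb mulmxBr mul_mx_scalar scaler_sumr walk_mxE mulmx_suml.
  rewrite [RHS](eq_bigr (fun z =>
    (\sum_x \sum_(y | face_prod x y == z) p x * b y) *: face_mx z
     - l *: (b z *: face_mx z))); last by move=> z _; rewrite /b' scalerBl scalerA.
  rewrite sumrB; congr (_ - _).
  rewrite (eq_bigr (fun y => \sum_x (p x * b y) *: face_mx (face_prod x y))); last first.
    move=> y _; rewrite mulmx_sumr; apply: eq_bigr => x _.
    by rewrite -scalemxAl -scalemxAr face_mxM scalerA mulrC.
  rewrite exchange_big /=.
  rewrite [RHS](eq_bigr (fun z =>
    \sum_x \sum_(y | face_prod x y == z) (p x * b y) *: face_mx z)); last first.
    by move=> z _; rewrite scaler_suml; apply: eq_bigr => x _; rewrite scaler_suml.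
  rewrite [RHS]exchange_big /=; apply: eq_bigr => x _.
  rewrite (partition_big (face_prod x) predT) //=; apply: eq_bigr => z _.
  by apply: eq_bigr => y /eqP ->.
rewrite big_cons /b' sumrB -mulr_sumr wb mulrBl; congr (_ - _).
rewrite -wb /flat_weight mulr_suml exchange_big /= [RHS]big_mkcond.
apply: eq_bigr => x _.
rewrite (exchange_big_dep predT) //= mulr_sumr.
transitivity (\sum_y if face_sub x X && face_sub y X then p x * b y else 0).
  apply: eq_bigr => y _; rewrite -face_sub_prod.
  rewrite (eq_bigl (fun z => (z == face_prod x y) && face_sub (face_prod x y) X)).
    case: ifP => h; last by rewrite big_pred0 // => z; rewrite andbF.
    by rewrite (big_pred1 (face_prod x y)) // => z; rewrite /= andbT.
  by move=> z; rewrite andbC eq_sym; case: eqP => //= ->.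
case: ifP => xX /=; last by rewrite big1.
by rewrite -big_mkcond.
Qed.

Section Trace.

Variables (gT : finGroupType) (W : {group gT}) (rW : mx_representation R W d).
Variable presA : preserves A rW.
Local Notation lact := (flat_act presA).
Local Notation Fix g := (rfix_mx rW <[g]>%g).

(* The character at g of the local summand of X, extended by conjugation; see
   [mxtrace_local_summand]. *)
Definition flat_char X g : R :=
  (-1) ^+ \rank (Fix g) * (-1) ^+ \rank (X :&: Fix g)%MS * fixed_moebius presA X g.

(** Expand the term of each flat over the fixed faces inside it by [twist_fixed_euler] and exchange
    the sums: the Moebius recursion leaves only the chambers, where the two signs agree. *)
Lemma mxtrace_face_mx x g : g \in W ->
  \tr (face_mx x *m chamber_repr presA g) =
  \sum_(X | (lact X g == X) && face_sub x X) flat_char X g.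
Proof.
move=> gW; pose phi := twist presA x g.
have -> : \tr (face_mx x *m chamber_repr presA g) = \sum_(c in chambers A) (phi c == c)%:R.
  rewrite big_enum_val /=; apply: eq_bigr => i _.
  have := face_mx_mul x (fun c j => (face_act presA c g == enum_val j)%:R) i i.
  by rewrite /chamber_repr /= /perm_repr_mx => ->.
rewrite /flat_char.
have charX X : (lact X g == X) && face_sub x X ->
  (-1) ^+ \rank (Fix g) * (-1) ^+ \rank (X :&: Fix g)%MS * fixed_moebius presA X g =
  \sum_(z | (phi z == z) && face_sub z X)
    (-1) ^+ \rank (Fix g) * (-1) ^+ \rank (supp z :&: Fix g)%MS * fixed_moebius presA X g.
  case/andP => /eqP Xg xX; rewrite -mulr_suml -mulr_sumr; congr (_ * _ * _).
  by rewrite (twist_fixed_euler gW Xg xX).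
rewrite (eq_bigr _ charX) (exchange_big_dep (fun z => phi z == z)) /=; last first.
  by move=> X z _ /andP[].
rewrite [LHS](big_mkcond (fun c => c \in chambers A)).
rewrite [RHS](big_mkcond (fun z => phi z == z)).
apply: eq_bigr => z _; case: eqP => [phz|_]; last by case: ifP.
have [zg xz] := twist_fixed_supp gW phz.
rewrite -mulr_sumr.
rewrite (eq_bigl (fun X => (lact X g == X) && (supp z <= (X : flat A))%MS)); last first.
  move=> X; rewrite -face_sub_supp; case: eqP => //= _; apply/andb_idl.
  by rewrite !face_sub_supp; apply: submx_trans; rewrite -face_sub_supp.
rewrite (fixed_moebius_sum gW zg) supp_full; case: ifP => zc; last by rewrite mulr0.
rewrite mulr1; have fz : (1%:M <= supp z)%MS by rewrite sub1mx supp_full.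
rewrite (capmx_idPr (submx_trans (submx1 _) fz)).
by rewrite -expr2 sqrr_sign.
Qed.

Variable p : face A -> R.

(** The coefficients of the projection over the faces inside X add up to the interpolation
    polynomial at the weight of X, which is 1 or 0. *)
Lemma mxtrace_walk_eigen_proj l g : g \in W ->
  \tr (eigen_proj (walk_mx p) (walk_weights p) l *m chamber_repr presA g) =
  \sum_(X | (lact X g == X) && (flat_weight p X == l)) flat_char X g.
Proof.
move=> gW; set s := walk_weights p.
have [b [eb wb]] := prod_sub_scalar_coef p (rem l s).
rewrite /eigen_proj eb -scalemxAl mxtraceZ mulmx_suml raddf_sum /=.
rewrite (eq_bigr (fun x =>
  \sum_(X | (lact X g == X) && face_sub x X) b x * flat_char X g)); last first.
  by move=> x _; rewrite -scalemxAl mxtraceZ mxtrace_face_mx // mulr_sumr.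
rewrite (exchange_big_dep (fun X => lact X g == X)) /=; last by move=> x X _ /andP[].
rewrite mulr_sumr [LHS]big_mkcond [RHS]big_mkcond; apply: eq_bigr => X _.
case: eqP => //= Xg; rewrite -mulr_suml wb mulrA.
have us : uniq s := undup_uniq _.
case: eqP => [->|/eqP Xl].
  rewrite mulVf ?mul1r // prodf_seq_neq0; apply/allP => a.
  by rewrite mem_rem_uniq // inE subr_eq0 eq_sym => /andP[].
have Xs : flat_weight p X \in rem l s by rewrite mem_rem_uniq // inE Xl mem_walk_weights.
by rewrite [X in _ * X * _](big_rem _ Xs) /= subrr mul0r mulr0 mul0r.
Qed.

End Trace.
End Walk.

(** * Induced summands *)

Lemma capmxMr_free (F : fieldType) m1 m2 n p (B : 'M[F]_(m1, n)) (C : 'M[F]_(m2, n))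
    (D : 'M[F]_(n, p)) : row_free D ->
  ((B :&: C) *m D :=: B *m D :&: C *m D)%MS.
Proof.
move=> fD; apply/eqmxP; rewrite capmxMr; apply/rV_subP => v.
rewrite sub_capmx => /andP[/submxP[b vb] /submxP[c vc]].
have e : b *m B = c *m C by apply: (row_free_inj fD); rewrite -!mulmxA -vb.
by rewrite vb mulmxA submxMr // sub_capmx submxMl e submxMl.
Qed.

Section Conjugation.

Variables (R : realFieldType) (d : nat) (A : arrangement R d).
Variables (gT : finGroupType) (W : {group gT}) (rW : mx_representation R W d).
Variable presA : preserves A rW.
Local Notation lact := (flat_act presA).
Local Notation Fix g := (rfix_mx rW <[g]>%g).
Implicit Types (X Y Z : flat A).

Lemma row_full_flat_act w X : w \in W -> row_full (lact X w) = row_full X.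
Proof. by move=> wW; rewrite /row_full rank_flat_act. Qed.

Lemma simplices_act w X k s : w \in W -> s \in simplices X k ->
  (lact^*)%act s w \in simplices (lact X w) k.
Proof.
move=> wW; rewrite !simplicesE => /chainsP[/subsetP sX sk /comparable_setP cs].
have inj := act_inj lact w.
apply/chainsP; split.
- apply/subsetP => _ /imsetP[Y Ys ->]; have := sX Y Ys.
  rewrite !inE !ltmx1 row_full_flat_act // => /andP[XY ->]; rewrite andbT.
  by rewrite -/(flat_lt _ _) flat_act_lt.
- by rewrite card_imset.
apply/comparable_setP => _ _ /imsetP[Y Ys ->] /imsetP[Z Zs ->].
by rewrite (inj_eq inj) !flat_act_lt //; apply: cs.
Qed.

Lemma mem_simplices_act w X k s : w \in W ->
  ((lact^*)%act s w \in simplices (lact X w) k) = (s \in simplices X k).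
Proof.
move=> wW; apply/idP/idP; last exact: simplices_act.
have wVW : w^-1%g \in W by rewrite groupV.
by move/(simplices_act wVW); rewrite (actKin _ wW) (actKin _ wW).
Qed.

Lemma fixed_moebius_act X g w : g \in W -> w \in W ->
  fixed_moebius presA (lact X w) g = fixed_moebius presA X (w * g * w^-1)%g.
Proof.
move=> gW wW; rewrite /fixed_moebius row_full_flat_act //; case: ifP => // _.
congr (- _); apply: eq_bigr => k _; congr (_ * _).
rewrite (reindex_inj (act_inj (lact^*)%act w)) /=; apply: eq_big => s.
  exact: mem_simplices_act.
move=> _; congr (_%:R); congr nat_of_bool.
rewrite -[RHS](inj_eq (act_inj (lact^*)%act w)) -!actMin ?groupM ?groupV //.
by rewrite mulgKV.
Qed.

Lemma rfix_conj g w : g \in W -> w \in W ->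
  (Fix (w * g * w^-1)%g *m rW w :=: Fix g)%MS.
Proof.
move=> gW wW; have sW : <[w * g * w^-1]>%g \subset W by rewrite cycle_subG !groupM ?groupV.
have e : (<[w * g * w^-1]> :^ w = <[g]>)%g.
  by rewrite -cycleJ conjgE !mulgA mulVg mul1g mulgKV.
by have := rfix_mx_conjsg rW wW sW; rewrite e => h; apply: eqmx_sym.
Qed.

(** With right actions, g stabilizes X w exactly when w g w^-1 stabilizes X. *)
Lemma flat_char_act X g w : g \in W -> w \in W ->
  flat_char presA (lact X w) g = flat_char presA X (w * g * w^-1)%g.
Proof.
move=> gW wW; rewrite /flat_char fixed_moebius_act // -!(rfix_conj gW wW).
have wfree : row_free (rW w) by rewrite row_free_unit repr_mx_unit.
rewrite mxrankMfree //; congr (_ * (-1) ^+ _ * _).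
rewrite -(mxrankMfree (X :&: _)%MS wfree); apply/eqmx_rank/andP.
have capM := capmxMr_free X (Fix (w * g * w^-1)%g) wfree.
split.
  rewrite capM sub_capmx (submx_trans (capmxSl _ _)) ?flat_actE //.
  by rewrite (submx_trans (capmxSr _ _)) // rfix_conj.
rewrite capM sub_capmx (submx_trans (capmxSl _ _)) ?flat_actE //.
by rewrite (submx_trans (capmxSr _ _)) // rfix_conj.
Qed.

End Conjugation.

Section Summand.

Variables (R : rcfType) (d : nat) (A : arrangement R d).
Variables (gT : finGroupType) (W : {group gT}) (rW : mx_representation R W d).
Variable presA : preserves A rW.
Local Notation lact := (flat_act presA).
Local Notation Fix g := (rfix_mx rW <[g]>%g).
Implicit Types (X Y Z : flat A).

Lemma mxtrace_local_summand X h : h \in flat_stab presA X ->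
  \tr (prod_repr (total_cohomology presA X) (det_quotient presA X) h) = flat_char presA X h.
Proof.
move=> hS; have [hW Xh] := flat_stabP hS.
rewrite /= mxtrace_prod mxtrace_total_cohomology //.
rewrite trace_mx11 mxE eqxx mulr1n.
have det := det_repr_sign (factmod_repr (flat_module presA X)) hS.
have sHG : <[h]>%g \subset flat_stab presA X by rewrite cycle_subG.
have rk := rank_rfix_sub_fact (flat_module presA X) sHG.
have dk : (-1) ^+ (d - \rank X) = (-1) ^+ \rank (cokermx X) :> R by rewrite mxrank_coker.
rewrite /flat_char (rk : \rank (Fix h) = _) exprD dk.
set a := (-1) ^+ \rank (X :&: _)%MS.
rewrite -[(-1) ^+ \rank (rfix_mx (factmod_repr _) _)]/(_ ^+ _) -det.
have aa : a * a = 1 by rewrite -expr2 sqrr_sign.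
rewrite [a * _]mulrC -[_ * a * a]mulrA aa mulr1.
by rewrite -[LHS]mulrA [fixed_moebius _ _ _ * _]mulrC mulrA.
Qed.

Lemma mem_flat_stab X h : h \in W -> (h \in flat_stab presA X) = (lact X h == X).
Proof. by move=> hW; rewrite !inE hW sub1set inE. Qed.

(** Coset representatives w_i of the stabilizer correspond to the points X w_i of the orbit, and the
    i-th diagonal block contributes exactly when g fixes X w_i. *)
Lemma mxtrace_flat_summand X g : g \in W ->
  \tr (flat_summand presA X g) =
  \sum_(Y in orbit lact W X | lact Y g == Y) flat_char presA Y g.
Proof.
move=> gW; rewrite /flat_summand /= /ind_repr_mx mxtrace_mxblock.
pose cr (i : 'I_#|rcosets (flat_stab presA X) W|) : gT := coset_rep i.
have crW i : cr i \in W.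
  have /rcosetsP[u uW e] := enum_valP i; rewrite /cr /coset_rep e.
  have /rcosetP[h hH ->] := mem_repr_rcoset (flat_stab presA X) u.
  by rewrite groupM // (subsetP (flat_stab_sub presA X)).
have orbE : orbit lact W X = [set lact X (cr i) | i : 'I__].
  apply/setP => Y; apply/orbitP/imsetP => [[w wW <-]|[i _ ->]]; last by exists (cr i).
  have C : (flat_stab presA X :* w)%g \in rcosets (flat_stab presA X) W.
    by apply/rcosetsP; exists w.
  exists (enum_rank_in C (flat_stab presA X :* w)%g) => //.
  rewrite /cr /coset_rep enum_rankK_in //.
  have /rcosetP[h hH ->] := mem_repr_rcoset (flat_stab presA X) w.
  by have [hW Xh] := flat_stabP hH; rewrite actMin // Xh.
have cr_inj : injective (fun i => lact X (cr i)).
  move=> i j e; apply: (@coset_rep_inj _ W (flat_stab presA X)).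
  rewrite mem_flat_stab ?groupM ?groupV ?crW //.
  rewrite actMin ?groupV ?crW // -/(cr i) e (actKin lact (crW j)).
  exact: eqxx.
rewrite big_mkcondr orbE big_imset /=; last by move=> i j _ _; apply: cr_inj.
apply: eq_bigr => i _; rewrite -/(cr i).
have conjW : (cr i * g * (cr i)^-1)%g \in W by rewrite !groupM ?groupV.
have mem_conj : (cr i * g * (cr i)^-1 \in flat_stab presA X)%g
    = (lact (lact X (cr i)) g == lact X (cr i)).
  rewrite (mem_flat_stab X conjW) -(inj_eq (act_inj lact (cr i))).
  by rewrite -(actMin lact _ conjW (crW i)) mulgKV actMin.
rewrite mem_conj; case: ifP => h; last by rewrite mxtrace0.
by rewrite flat_char_act ?crW // -mxtrace_local_summand // mem_conj.
Qed.

End Summand.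

(** * Invariance of the weights, sums over orbits, and the theorem *)

Lemma map_prod_sub_scalar (F K : fieldType) (f : {rmorphism F -> K}) n (T : 'M[F]_n) s :
  map_mx f (prod_sub_scalar T s) = prod_sub_scalar (map_mx f T) (map f s).
Proof.
elim: s => [|a s IHs] /=; first exact: map_mx1.
by rewrite map_mxM IHs map_mxB map_scalar_mx.
Qed.

Section Equivariance.

Variables (R : realFieldType) (d : nat) (A : arrangement R d).
Variables (gT : finGroupType) (W : {group gT}) (rW : mx_representation R W d).
Variable presA : preserves A rW.
Local Notation lact := (flat_act presA).
Variable p : face A -> R.
Hypothesis pW : forall g x, g \in W -> p (face_act presA x g) = p x.

Lemma flat_weight_act X g : g \in W -> flat_weight p (lact X g) = flat_weight p X.
Proof.
move=> gW; rewrite /flat_weight (reindex_inj (act_inj (face_act presA) g)) /=.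
apply: eq_big => x; first by rewrite face_sub_act.
by move=> _; rewrite pW.
Qed.

Lemma weight_level_acts l : [acts W, on [set X : flat A | flat_weight p X == l] | lact].
Proof.
apply/subsetP => g gW; rewrite inE gW inE; apply/subsetP => X.
by rewrite !inE flat_weight_act.
Qed.

End Equivariance.

Lemma sum_orbit_transversal (V : nmodType) (gT : finGroupType) (D : {group gT})
    (S : finType) (to : action D S) (G : {group gT}) (B : {set S}) (F : S -> V) :
    [acts G, on B | to] ->
  \sum_(x in orbit_transversal to G B) \sum_(y in orbit to G x) F y = \sum_(y in B) F y.
Proof.
move=> nB; have [_ sub inj ex] := orbit_transversalP nB.
have sGD := acts_dom nB.
rewrite (set_partition_big _ (orbit_partition nB)) /=.
have -> : orbit to G @: B = orbit to G @: orbit_transversal to G B.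
  apply/setP => C; apply/imsetP/imsetP => -[x xB ->]; last first.
    by exists x => //; apply: (subsetP sub).
  have [a aG xaT] := ex x xB; exists (to x a) => //.
  by rewrite orbit_act_in.
rewrite [RHS]big_imset // => x y xT yT e.
by apply/eqP; rewrite -(inj _ _ xT yT) e orbit_refl.
Qed.

Section GrothendieckSum.

Variables (F : numFieldType) (gT : finGroupType) (G : {group gT}).

Lemma grothendieck_class_dadd (M N : representation F G) :
  grothendieck_class (dadd_grepr M N) = grothendieck_class M + grothendieck_class N.
Proof.
apply: grothendieck_class_exact.
exists (row_mx 1%:M 0 : 'M_(rdegree M, rdegree M + rdegree N)), (col_mx 0 1%:M).
split=> [g gG|g gG|||] /=.
- by rewrite mul_mx_row mul_row_block !(mulmx1, mul1mx, mulmx0, mul0mx, addr0, add0r).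
- by rewrite mul_block_col mul_col_mx !(mulmx1, mul1mx, mulmx0, mul0mx, addr0, add0r).
- apply/row_freeP; exists (col_mx 1%:M 0).
  by rewrite mul_row_col mulmx1 mul0mx addr0.
- apply/row_fullP; exists (row_mx 0 1%:M).
  by rewrite mul_row_col mulmx1 mul0mx add0r.
apply/eqmxP/andP; split.
  by apply/sub_kermxP; rewrite mul_row_col mulmx0 mul0mx addr0.
apply/rV_subP => v /sub_kermxP; rewrite -{1}[v]hsubmxK mul_row_col mulmx0 add0r mulmx1.
move=> v0; apply/submxP; exists (lsubmx v).
by rewrite -[LHS]hsubmxK v0 mul_mx_row mulmx1 mulmx0.
Qed.

Lemma grothendieck_class_sum (I : Type) (r : seq I) (P : pred I)
    (M : I -> representation F G) :
  grothendieck_class (\big[dadd_grepr/grepr0]_(i <- r | P i) M i)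
  = \sum_(i <- r | P i) grothendieck_class (M i).
Proof.
elim/big_rec2: _ => [|i c N _ <-]; first exact: grothendieck_class0.
exact: grothendieck_class_dadd.
Qed.

End GrothendieckSum.

Theorem theorem4p9 (R : realType) (d : nat) (A : arrangement R d)
    (essA : essential A)
    (gT : finGroupType) (W : {group gT}) (rW : mx_representation R W d)
    (faithW : mx_faithful rW) (presA : preserves A rW)
    (p : face A -> R) (p_ge0 : forall x : face A, 0 <= p x)
    (pW : forall (g : gT) (x : face A), g \in W -> p (face_act presA x g) = p x) :
  [/\ mxsemisimpleT (chamber_repr presA) (walk_mx p),
      forall a : R[i],
        eigenvalue (map_mx (real_complex R) (walk_mx p)) a ->
        exists X : flat A, a = (flat_weight p X)%:C%C
    & forall lam : R,
        grothendieck_class (eigenspace_repr lam pW) =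
        \sum_(X in orbit_transversal (flat_act presA) W
                     [set X : flat A | flat_weight p X == lam])
          grothendieck_class (flat_summand presA X)].
Proof.
have TG := walk_mx_comm pW.
have ann := walk_annihilated p_ge0.
have us : uniq (walk_weights p) := undup_uniq _.
split.
- by have := mxsemisimpleT_diag TG us ann.
(* Nonreal eigenvalues are excluded as well: the annihilating product, extended to the complex
   numbers, acts on an eigenvector by the product of the a - lambda, so one factor vanishes. *)
- move=> a /eigenvalueP[v vT nzv].
  have va : (v <= eigenspace (map_mx (real_complex R) (walk_mx p)) a)%MS.
    exact/eigenspaceP.
  have := eigenspace_prod_sub_scalar (map (real_complex R) (walk_weights p)) va.
  rewrite -map_prod_sub_scalar ann map_mx0 mulmx0 => /esym/eqP.
  rewrite scaler_eq0 (negPf nzv) orbF prodf_seq_eq0 => /hasP[b /mapP[c]].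
  move=> /walk_weightsP[X ->] -> /=; rewrite subr_eq0 => /eqP ->; by exists X.
move=> lam; rewrite -grothendieck_class_sum.
apply: grothendieck_class_trace => g gW.
rewrite mxtrace_dadd.
(* The eigenspace is the same; only the proof that it is a submodule changes. *)
transitivity (\tr (submod_repr (eigenspace_mxmodule TG lam) g)).
  exact: mxtrace_submod_eq.
rewrite (mxtrace_eigen_proj TG us ann) // mxtrace_walk_eigen_proj //.
rewrite [RHS](eq_bigr (fun X => \sum_(Y in orbit (flat_act presA) W X)
   if flat_act presA Y g == Y then flat_char presA Y g else 0)); last first.
  by move=> X _; have := mxtrace_flat_summand presA X gW; rewrite big_mkcondr.
rewrite [RHS](sum_orbit_transversal _ (weight_level_acts pW lam)).
rewrite -[RHS]big_mkcondr; apply: eq_bigl => X; by rewrite inE andbC.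
Qed.
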